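(* Let $\Omega \subseteq \mathbb{C}$ be a bounded convex domain and $F \subseteq \mathbb{N}_0$ be a non-empty set. Then $H_{F}^{\infty}(\Omega)=H_{\widetilde{F}_0}^{\infty}(\Omega)$ (as sets), where $\widetilde{F}_0=\{ l\in \mathbb{N}_0:0\leqslant l \leqslant \sup F\}$.
   Context: $\mathbb{N}_0=\{0,1,2,\dots\}$; $\sup F$ may be $+\infty$. For an open set $\Omega\subseteq\mathbb{C}$ and a non-empty set $F\subseteq\mathbb{N}_0$, $H_F^\infty(\Omega)$ is the set of holomorphic functions $f$ on $\Omega$ such that the derivative $f^{(l)}$ is bounded on $\Omega$ for all $l\in F$. *)

(* Defs.v *)
From Stdlib Require Import Reals.
From Coquelicot Require Import Coquelicot.

Definition C_connected (D : C -> Prop) : Prop :=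
  forall U V : C -> Prop,
    open U -> open V ->
    (forall z, D z -> U z \/ V z) ->
    (exists z, D z /\ U z) ->
    (exists z, D z /\ V z) ->
    exists z, D z /\ U z /\ V z.

Definition C_domain (D : C -> Prop) : Prop :=
  open D /\ (exists z, D z) /\ C_connected D.

Definition C_convex (D : C -> Prop) : Prop :=
  forall (z w : C) (t : R), D z -> D w -> (0 <= t <= 1)%R ->
    D (RtoC (1 - t) * z + RtoC t * w)%C.

Definition C_bounded (D : C -> Prop) : Prop :=
  exists M : R, forall z, D z -> (Cmod z <= M)%R.

(* Coquelicot only iterates the derivative of functions R -> R (Derive_n).
   [C_derive] is total; its value at z depends on f only near z, and it is the
   complex derivative wherever that derivative exists. *)
Fixpoint C_derive_n (f : C -> C) (n : nat) : C -> C :=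
  match n with
  | O => f
  | S m => C_derive (C_derive_n f m)
  end.

(* Complex differentiability at each point of D: the scalars of [ex_derive]
   are complex. *)
Definition holomorphic_on (D : C -> Prop) (f : C -> C) : Prop :=
  forall z, D z -> ex_derive (K := C_AbsRing) (V := C_NormedModule) f z.

(* Functions on the open set D are represented by total functions of which
   only the restriction to D matters. *)
Definition Hinf (F : nat -> Prop) (D : C -> Prop) (f : C -> C) : Prop :=
  holomorphic_on D f /\
  forall l, F l -> exists M : R, forall z, D z -> (Cmod (C_derive_n f l z) <= M)%R.

Definition sup_nat (F : nat -> Prop) : Rbar :=
  Lub_Rbar (fun x => exists n, F n /\ x = INR n).

Definition Ftilde0 (F : nat -> Prop) (l : nat) : Prop :=
  Rbar_le (INR l) (sup_nat F).

(* Main.v *)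
(** The bounded set of orders is propagated downwards: on a bounded convex domain a holomorphic
    function with bounded derivative is Lipschitz, hence bounded, so boundedness of the m-th
    derivative gives that of every derivative of order l <= m, provided all derivatives are
    themselves differentiable.

    That provision is proved from complex differentiability alone.  Goursat's bisection argument
    gives local primitives F' = f and E' = F.  As f is locally bounded, E satisfies a Taylor
    estimate with a uniform quadratic error, which is enough to differentiate under the integral
    sign and to prove Cauchy's formula for E on a circle; the Cauchy kernel can then be
    differentiated as often as desired. *)

Require Import Defs.
From Stdlib Require Import Reals Lra Lia Classical.
From Coquelicot Require Import Coquelicot.

(** * Calculus of complex-valued functions *)

(** Complex differentiability of f carries no continuity of its derivative, so f itself has no
    uniform Taylor estimate to start from. Integrating twice moves the problem to E, whose second
    derivative is f: differentiability of f at one point already bounds f nearby, and a bound on the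
    second derivative is exactly what a quadratic remainder requires. Once Cauchy's formula holds
    for E, uniqueness of derivatives identifies F and then f with Cauchy integrals of higher order,
    and further derivatives of f come from the kernel. Integrals and mean value estimates are taken
    on real and imaginary parts separately. Each such estimate costs a factor 2, which explains most
    of the factors 2 in the constants; none of the bounds is meant to be sharp. *)

Lemma minus_plus_l (G : AbelianGroup) (x h : G) : minus (plus x h) x = h.
Proof.
unfold minus. rewrite (plus_comm x h), <- plus_assoc.
etransitivity; [apply f_equal, plus_opp_r|apply plus_zero_r].
Qed.

Lemma plus_minus_l (G : AbelianGroup) (x y : G) : plus x (minus y x) = y.
Proof.
unfold minus. rewrite (plus_comm y), plus_assoc.
etransitivity; [apply (f_equal (fun z => plus z y)), plus_opp_r|apply plus_zero_l].
Qed.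

(** Replaces filters by a remainder bound that contains no division and makes sense at h = 0. The
    general form yields the real and the complex case by conversion. *)
Lemma is_derive_eps (K : AbsRing) (V : NormedModule K) (f : K -> V) (x : K) (l : V) :
  is_derive f x l <->
  forall eps, 0 < eps -> exists del, 0 < del /\ forall h : K, abs h < del ->
    norm (minus (minus (f (plus x h)) (f x)) (scal h l)) <= eps * abs h.
Proof.
split.
- intros [_ H] eps Heps.
  destruct (H x (fun P HP => HP) (mkposreal eps Heps)) as [d Hd].
  exists d; split; [apply cond_pos|]. intros h Hh.
  assert (E := minus_plus_l K x h).
  assert (Hb := eq_ind_r (fun u : K => abs u < d) Hh E).
  exact (eq_ind _ (fun u : K => norm (minus (minus (f (plus x h)) (f x)) (scal u l)) <= eps * abs u)
    (Hd _ Hb) _ E).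
- intros H; split; [apply is_linear_scal_l|].
  intros y Hy. apply (is_filter_lim_locally_unique x y) in Hy; subst y.
  intros eps. destruct (H eps (cond_pos eps)) as [d [Hd0 Hd]].
  exists (mkposreal d Hd0). intros y Hy.
  exact (eq_ind _ (fun u : K => norm (minus (minus (f u) (f x)) (scal (@minus K y x) l)) <=
    eps * abs (@minus K y x)) (Hd _ Hy) _ (plus_minus_l K x y)).
Qed.

Definition cder (f : C -> C) (z l : C) : Prop :=
  is_derive (K := C_AbsRing) (V := C_NormedModule) f z l.

Lemma cder_eps (f : C -> C) (z l : C) :
  cder f z l <->
  forall eps, 0 < eps -> exists del, 0 < del /\ forall h : C, Cmod h < del ->
    Cmod (f (z + h) - f z - h * l)%C <= eps * Cmod h.
Proof. exact (is_derive_eps C_AbsRing C_NormedModule f z l). Qed.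

Lemma is_derive_R_eps (f : R -> R) (x l : R) :
  is_derive f x l <->
  forall eps, 0 < eps -> exists del, 0 < del /\ forall h, Rabs h < del ->
    Rabs (f (x + h) - f x - h * l) <= eps * Rabs h.
Proof. exact (is_derive_eps R_AbsRing R_NormedModule f x l). Qed.

Lemma Cmod_le_Rabs (z : C) : Cmod z <= Rabs (fst z) + Rabs (snd z).
Proof.
destruct z as [x y]; simpl.
replace (x, y) with (RtoC x + RtoC y * Ci)%C.
2:{ unfold Ci, RtoC, Cplus, Cmult; simpl; f_equal; ring. }
eapply Rle_trans; [apply Cmod_triangle|].
rewrite Cmod_mult, Cmod_Ci, !Cmod_R; lra.
Qed.

Lemma Rabs_fst_le (z : C) : Rabs (fst z) <= Cmod z.
Proof. eapply Rle_trans; [apply Rmax_l|apply Rmax_Cmod]. Qed.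

Lemma Rabs_snd_le (z : C) : Rabs (snd z) <= Cmod z.
Proof. eapply Rle_trans; [apply Rmax_r|apply Rmax_Cmod]. Qed.

Lemma Cmod_sub_sym (x y : C) : Cmod (x - y) = Cmod (y - x).
Proof. rewrite <- Cmod_opp; f_equal; ring. Qed.

Lemma Cmod_sub_le (x y : C) : Cmod (x - y) <= Cmod x + Cmod y.
Proof. unfold Cminus. eapply Rle_trans; [apply Cmod_triangle|]. rewrite Cmod_opp; lra. Qed.

Lemma Cmod_sub_tri (x y z : C) : Cmod (x - z) <= Cmod (x - y) + Cmod (y - z).
Proof. replace (x - z)%C with ((x - y) + (y - z))%C by ring. apply Cmod_triangle. Qed.

(** Componentwise, so that the real differentiation rules and the real fundamental theorem apply
    directly. [rder_eps] recovers the remainder form with [Cmod], which the chain rule needs. *)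
Definition rder (g : R -> C) (t : R) (l : C) : Prop :=
  is_derive (fun s => fst (g s)) t (fst l) /\ is_derive (fun s => snd (g s)) t (snd l).

Lemma rder_eps (g : R -> C) (t : R) (l : C) :
  rder g t l <->
  forall eps, 0 < eps -> exists del, 0 < del /\ forall h, Rabs h < del ->
    Cmod (g (t + h)%R - g t - RtoC h * l)%C <= eps * Rabs h.
Proof.
split.
- intros [H1 H2] eps He.
  apply is_derive_R_eps with (eps := eps / 2) in H1; [|lra].
  apply is_derive_R_eps with (eps := eps / 2) in H2; [|lra].
  destruct H1 as [d1 [P1 H1]], H2 as [d2 [P2 H2]].
  exists (Rmin d1 d2); split; [now apply Rmin_pos|].
  intros h Hh.
  specialize (H1 h (Rlt_le_trans _ _ _ Hh (Rmin_l _ _))).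
  specialize (H2 h (Rlt_le_trans _ _ _ Hh (Rmin_r _ _))).
  eapply Rle_trans; [apply Cmod_le_Rabs|].
  cbn. replace (fst (g (t + h)) + - fst (g t) + - (h * fst l - 0 * snd l))
    with (fst (g (t + h)) - fst (g t) - h * fst l) by ring.
  replace (snd (g (t + h)) + - snd (g t) + - (h * snd l + 0 * fst l))
    with (snd (g (t + h)) - snd (g t) - h * snd l) by ring.
  lra.
- intros H; split; apply is_derive_R_eps; intros eps He;
    destruct (H eps He) as [d [P Hd]]; exists d; split; auto; intros h Hh;
    (eapply Rle_trans; [|apply Hd, Hh]).
  + eapply Rle_trans; [|apply Rabs_fst_le]; apply Req_le; f_equal; cbn; ring.
  + eapply Rle_trans; [|apply Rabs_snd_le]; apply Req_le; f_equal; cbn; ring.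
Qed.

Lemma cder_locally_lipschitz (f : C -> C) (z l : C) :
  cder f z l -> exists del, 0 < del /\ forall h, Cmod h < del ->
    Cmod (f (z + h) - f z)%C <= (1 + Cmod l) * Cmod h.
Proof.
intros H. apply cder_eps with (eps := 1) in H; [|lra].
destruct H as [d [P H]]. exists d; split; auto. intros h Hh. specialize (H h Hh).
replace (f (z + h) - f z)%C with ((f (z + h) - f z - h * l) + h * l)%C by ring.
eapply Rle_trans; [apply Cmod_triangle|]. rewrite Cmod_mult. lra.
Qed.

Lemma cder_continuous (f : C -> C) (z l : C) (eps : R) :
  cder f z l -> 0 < eps -> exists del, 0 < del /\ forall h, Cmod h < del ->
    Cmod (f (z + h) - f z)%C <= eps.
Proof.
intros H He. destruct (cder_locally_lipschitz f z l H) as [d [P Hd]].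
pose proof (Cmod_ge_0 l).
exists (Rmin d (eps / (1 + Cmod l))); split.
- apply Rmin_pos; auto. apply Rdiv_lt_0_compat; lra.
- intros h Hh. eapply Rle_trans; [apply Hd; eapply Rlt_le_trans; [apply Hh|apply Rmin_l]|].
  assert (Cmod h <= eps / (1 + Cmod l)).
  { left; eapply Rlt_le_trans; [apply Hh|apply Rmin_r]. }
  replace eps with ((1 + Cmod l) * (eps / (1 + Cmod l))) by (field; lra).
  apply Rmult_le_compat_l; lra.
Qed.

(** With u the increment of g, the error is the remainder of f at u plus l times the remainder of g
    at h. Each gets half of eps, the first after |u| <= k |h| with k = 1 + |m|. The 1 in 1 + |l|
    avoids dividing by zero. *)
Lemma rder_cder_comp (f : C -> C) (g : R -> C) (t : R) (l m : C) :
  cder f (g t) l -> rder g t m -> rder (fun s => f (g s)) t (l * m)%C.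
Proof.
intros Hf Hg. apply rder_eps. intros eps He.
assert (Hg1 := proj1 (rder_eps _ _ _) Hg 1 Rlt_0_1).
destruct Hg1 as [d1 [P1 Hg1]].
pose proof (Cmod_ge_0 l). pose proof (Cmod_ge_0 m).
set (k := 1 + Cmod m). assert (0 < k) by (unfold k; lra).
assert (Hk : forall h, Rabs h < d1 -> Cmod (g (t + h)%R - g t) <= k * Rabs h).
{ intros h Hh. specialize (Hg1 h Hh).
  replace (g (t + h)%R - g t)%C with ((g (t + h)%R - g t - RtoC h * m) + RtoC h * m)%C by ring.
  eapply Rle_trans; [apply Cmod_triangle|]. rewrite Cmod_mult, Cmod_R. unfold k; lra. }
assert (E1 : 0 < eps / (2 * k)) by (apply Rdiv_lt_0_compat; lra).
assert (E2 : 0 < eps / (2 * (1 + Cmod l))) by (apply Rdiv_lt_0_compat; lra).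
destruct (proj1 (cder_eps _ _ _) Hf _ E1) as [d2 [P2 Hf2]].
destruct (proj1 (rder_eps _ _ _) Hg _ E2) as [d3 [P3 Hg3]].
assert (P4 : 0 < d2 / k) by (apply Rdiv_lt_0_compat; lra).
exists (Rmin d1 (Rmin (d2 / k) d3)); split; [repeat apply Rmin_pos; auto|].
intros h Hh.
assert (Hh1 : Rabs h < d1) by (eapply Rlt_le_trans; [apply Hh|apply Rmin_l]).
assert (Hh' : Rabs h < Rmin (d2 / k) d3) by (eapply Rlt_le_trans; [apply Hh|apply Rmin_r]).
assert (Hh2 : Rabs h < d2 / k) by (eapply Rlt_le_trans; [apply Hh'|apply Rmin_l]).
assert (Hh3 : Rabs h < d3) by (eapply Rlt_le_trans; [apply Hh'|apply Rmin_r]).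
specialize (Hk h Hh1). specialize (Hg3 h Hh3).
set (u := (g (t + h)%R - g t)%C) in *.
assert (Hu : Cmod u < d2).
{ eapply Rle_lt_trans; [apply Hk|].
  replace d2 with (k * (d2 / k)) by (field; lra).
  apply Rmult_lt_compat_l; lra. }
specialize (Hf2 u Hu).
replace (g t + u)%C with (g (t + h)%R) in Hf2 by (unfold u; ring).
replace (f (g (t + h)%R) - f (g t) - RtoC h * (l * m))%C with
  ((f (g (t + h)%R) - f (g t) - u * l) + l * (u - RtoC h * m))%C by ring.
eapply Rle_trans; [apply Cmod_triangle|]. rewrite Cmod_mult.
assert (A1 : eps / (2 * k) * Cmod u <= eps / 2 * Rabs h).
{ replace (eps / 2 * Rabs h) with (eps / (2 * k) * (k * Rabs h)) by (field; lra).
  apply Rmult_le_compat_l; lra. }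
assert (A2 : Cmod l * Cmod (u - RtoC h * m) <= eps / 2 * Rabs h).
{ replace (eps / 2 * Rabs h) with ((1 + Cmod l) * (eps / (2 * (1 + Cmod l)) * Rabs h)) by (field; lra).
  apply Rmult_le_compat; try lra; apply Cmod_ge_0. }
lra.
Qed.

Lemma rder_ext (f g : R -> C) (t : R) (l m : C) :
  (forall s, f s = g s) -> l = m -> rder f t l -> rder g t m.
Proof.
intros E <- [H1 H2]; split; eapply is_derive_ext; try eassumption; intros; simpl; now rewrite E.
Qed.

Lemma rder_const (c : C) (t : R) : rder (fun _ => c) t 0.
Proof. split; apply (is_derive_const (V := R_NormedModule)). Qed.

Lemma rder_id (t : R) : rder RtoC t 1.
Proof. split; [apply (is_derive_id (K := R_AbsRing))|apply (is_derive_const (V := R_NormedModule) 0)]. Qed.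

Lemma rder_plus (f g : R -> C) (t : R) (l m : C) :
  rder f t l -> rder g t m -> rder (fun s => f s + g s)%C t (l + m)%C.
Proof. intros [H1 H2] [H3 H4]; split; apply (is_derive_plus (V := R_NormedModule)); auto. Qed.

Lemma rder_minus (f g : R -> C) (t : R) (l m : C) :
  rder f t l -> rder g t m -> rder (fun s => f s - g s)%C t (l - m)%C.
Proof. intros [H1 H2] [H3 H4]; split; apply (is_derive_minus (V := R_NormedModule)); auto. Qed.

Lemma is_derive_mult_R (f g : R -> R) (t l m : R) :
  is_derive f t l -> is_derive g t m -> is_derive (fun s => f s * g s) t (l * g t + f t * m).
Proof. intros H1 H2; apply (is_derive_mult (K := R_AbsRing)); auto. intros; apply Rmult_comm. Qed.

Lemma rder_mult (f g : R -> C) (t : R) (l m : C) :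
  rder f t l -> rder g t m -> rder (fun s => f s * g s)%C t (l * g t + f t * m)%C.
Proof.
intros [H1 H2] [H3 H4]; split; cbn.
- replace (fst l * fst (g t) - snd l * snd (g t) + (fst (f t) * fst m - snd (f t) * snd m)) with
   ((fst l * fst (g t) + fst (f t) * fst m) - (snd l * snd (g t) + snd (f t) * snd m)) by ring.
  apply (is_derive_minus (V := R_NormedModule)); now apply is_derive_mult_R.
- replace (fst l * snd (g t) + snd l * fst (g t) + (fst (f t) * snd m + snd (f t) * fst m)) with
   ((fst l * snd (g t) + fst (f t) * snd m) + (snd l * fst (g t) + snd (f t) * fst m)) by ring.
  apply (is_derive_plus (V := R_NormedModule)); now apply is_derive_mult_R.
Qed.

(** The remainder is exactly h^2 / ((z + h) z^2). Keeping |h| below m / 2 gives |z + h| >= m / 2;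
    the second bound on |h| then produces eps. *)
Lemma cder_inv (z : C) : z <> 0 -> cder Cinv z (- (/ z * / z))%C.
Proof.
intros Hz. apply cder_eps. intros eps He.
assert (Hm := proj1 (Cmod_gt_0 z) Hz). set (m := Cmod z) in *.
assert (P : 0 < eps * m ^ 3 / 2) by (pose proof (pow_lt m 3 Hm); apply Rdiv_lt_0_compat; [apply Rmult_lt_0_compat|]; lra).
exists (Rmin (m / 2) (eps * m ^ 3 / 2)); split; [apply Rmin_pos; lra|].
intros h Hh.
assert (Hh1 : Cmod h < m / 2) by (eapply Rlt_le_trans; [apply Hh|apply Rmin_l]).
assert (Hh2 : Cmod h < eps * m ^ 3 / 2) by (eapply Rlt_le_trans; [apply Hh|apply Rmin_r]).
assert (Hzh : m / 2 <= Cmod (z + h)).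
{ assert (Hq := Cmod_sub_le (z + h) h). replace (z + h - h)%C with z in Hq by ring. fold m in Hq. lra. }
assert (Hnz : (z + h)%C <> 0) by (apply Cmod_gt_0; lra).
replace (/ (z + h) - / z - h * - (/ z * / z))%C with (h * h * / (z + h) * / z * / z)%C by (field; auto).
rewrite !Cmod_mult, !Cmod_inv by auto. fold m.
assert (/ Cmod (z + h) <= / (m / 2)) by (apply Rinv_le_contravar; lra).
pose proof (Cmod_ge_0 h).
assert (0 < / m) by (now apply Rinv_0_lt_compat).
assert (Cmod h * / Cmod (z + h) * / m * / m <= eps).
{ apply Rle_trans with (eps * m ^ 3 / 2 * / (m / 2) * / m * / m).
  - repeat apply Rmult_le_compat_r; try lra.
    apply Rmult_le_compat; try lra. left; apply Rinv_0_lt_compat; lra.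
  - right; field; lra. }
replace (Cmod h * Cmod h * / Cmod (z + h) * / m * / m) with
  ((Cmod h * / Cmod (z + h) * / m * / m) * Cmod h) by ring.
apply Rmult_le_compat_r; lra.
Qed.

Lemma rder_inv (g : R -> C) (t : R) (l : C) :
  g t <> 0 -> rder g t l -> rder (fun s => / g s)%C t (- (/ g t * / g t) * l)%C.
Proof. intros Hn Hg. apply (rder_cder_comp Cinv g); auto. now apply cder_inv. Qed.

Lemma rder_segment (u v : C) (t : R) : rder (fun t => u + RtoC t * v)%C t v.
Proof.
eapply rder_ext; [reflexivity| |apply rder_plus; [apply rder_const|apply rder_mult; [apply rder_id|apply rder_const]]].
cbv beta; ring.
Qed.

(** Serves integrands: differentiability in the real parameter gives continuity, hence
    integrability, without computing a derivative. *)
Definition rdiff (g : R -> C) (t : R) : Prop := exists l, rder g t l.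

Lemma rdiff_const (c : C) (t : R) : rdiff (fun _ => c) t.
Proof. eexists; apply rder_const. Qed.

Lemma rdiff_plus (f g : R -> C) (t : R) : rdiff f t -> rdiff g t -> rdiff (fun s => f s + g s)%C t.
Proof. intros [l Hl] [m Hm]; eexists; apply rder_plus; eauto. Qed.

Lemma rdiff_minus (f g : R -> C) (t : R) : rdiff f t -> rdiff g t -> rdiff (fun s => f s - g s)%C t.
Proof. intros [l Hl] [m Hm]; eexists; apply rder_minus; eauto. Qed.

Lemma rdiff_mult (f g : R -> C) (t : R) : rdiff f t -> rdiff g t -> rdiff (fun s => f s * g s)%C t.
Proof. intros [l Hl] [m Hm]; eexists; apply rder_mult; eauto. Qed.

Lemma rdiff_inv (g : R -> C) (t : R) : g t <> 0 -> rdiff g t -> rdiff (fun s => / g s)%C t.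
Proof. intros Hn [l Hl]; eexists; apply rder_inv; eauto. Qed.

Lemma rdiff_pow (g : R -> C) (t : R) (n : nat) : rdiff g t -> rdiff (fun s => g s ^ n)%C t.
Proof.
intros H; induction n; simpl; [apply rdiff_const|now apply rdiff_mult].
Qed.

Lemma rdiff_segment (u v : C) (t : R) : rdiff (fun t => u + RtoC t * v)%C t.
Proof. eexists; apply rder_segment. Qed.

Lemma rdiff_cder_comp (f : C -> C) (g : R -> C) (t : R) (l : C) :
  cder f (g t) l -> rdiff g t -> rdiff (fun s => f (g s)) t.
Proof. intros H [m Hm]; eexists; eapply rder_cder_comp; eauto. Qed.

(** * Integrals of complex-valued functions of a real variable *)

Definition CI (g : R -> C) (a b : R) : C :=
  (RInt (fun t => fst (g t)) a b, RInt (fun t => snd (g t)) a b).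

Definition ex_CI (g : R -> C) (a b : R) : Prop :=
  ex_RInt (fun t => fst (g t)) a b /\ ex_RInt (fun t => snd (g t)) a b.

Lemma ex_CI_rdiff (g : R -> C) (a b : R) :
  a <= b -> (forall t, a <= t <= b -> rdiff g t) -> ex_CI g a b.
Proof.
intros Hab H; split; apply (ex_RInt_continuous (V := R_CompleteNormedModule));
  rewrite Rmin_left, Rmax_right by auto; intros t Ht; destruct (H t Ht) as [l [H1 H2]];
  apply (ex_derive_continuous (K := R_AbsRing) (V := R_NormedModule)); eexists; eassumption.
Qed.

Lemma CI_ext (f g : R -> C) (a b : R) :
  a <= b -> (forall t, a <= t <= b -> f t = g t) -> CI f a b = CI g a b.
Proof.
intros Hab H; unfold CI; f_equal; apply RInt_ext; rewrite Rmin_left, Rmax_right by auto;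
  intros t Ht; rewrite H by lra; reflexivity.
Qed.

Lemma CI_minus (f g : R -> C) (a b : R) :
  ex_CI f a b -> ex_CI g a b -> CI (fun t => f t - g t)%C a b = (CI f a b - CI g a b)%C.
Proof.
intros [H1 H2] [H3 H4]. unfold CI, Cminus, Cplus, Copp; cbn [fst snd].
f_equal; now apply (RInt_minus (V := R_CompleteNormedModule)).
Qed.

Lemma CI_scal (c : C) (f : R -> C) (a b : R) :
  ex_CI f a b -> CI (fun t => c * f t)%C a b = (c * CI f a b)%C.
Proof.
intros [H1 H2]. unfold CI, Cmult; cbn [fst snd].
assert (S : forall (k : R) g, ex_RInt g a b -> RInt (fun t => k * g t) a b = k * RInt g a b).
{ intros k g Hg. now apply (RInt_scal (V := R_CompleteNormedModule)). }
assert (E : forall (k : R) g, ex_RInt g a b -> ex_RInt (fun t => k * g t) a b).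
{ intros k g Hg. now apply (ex_RInt_scal (V := R_NormedModule)). }
f_equal.
- rewrite (RInt_minus (V := R_CompleteNormedModule) (fun t => fst c * fst (f t)) (fun t => snd c * snd (f t))) by auto.
  rewrite !S by auto. reflexivity.
- rewrite (RInt_plus (V := R_CompleteNormedModule) (fun t => fst c * snd (f t)) (fun t => snd c * fst (f t))) by auto.
  rewrite !S by auto. reflexivity.
Qed.

(* The factor 2 is the price of estimating real and imaginary parts separately. *)
Lemma Cmod_CI_le (f : R -> C) (a b M : R) :
  a <= b -> ex_CI f a b -> (forall t, a <= t <= b -> Cmod (f t) <= M) ->
  Cmod (CI f a b) <= 2 * M * (b - a).
Proof.
intros Hab [H1 H2] HM.
eapply Rle_trans; [apply Cmod_le_Rabs|]. unfold CI; cbn [fst snd].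
assert (A : forall g, ex_RInt g a b -> (forall t, a <= t <= b -> Rabs (g t) <= M) ->
            Rabs (RInt g a b) <= (b - a) * M).
{ intros g Hg HgM. apply (norm_RInt_le_const (V := R_NormedModule) g); auto.
  now apply (RInt_correct (V := R_CompleteNormedModule)). }
assert (A1 := A _ H1 (fun t Ht => Rle_trans _ _ _ (Rabs_fst_le (f t)) (HM t Ht))).
assert (A2 := A _ H2 (fun t Ht => Rle_trans _ _ _ (Rabs_snd_le (f t)) (HM t Ht))).
lra.
Qed.

(** The fundamental theorem for each component; [rdiff g] supplies the continuity of the derivative
    that it asks for. *)
Lemma CI_rder (f g : R -> C) (a b : R) :
  a <= b -> (forall t, a <= t <= b -> rder f t (g t)) ->
  (forall t, a <= t <= b -> rdiff g t) -> CI g a b = (f b - f a)%C.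
Proof.
intros Hab H Hg.
unfold CI, Cminus, Cplus, Copp; cbn [fst snd].
f_equal; apply is_RInt_unique.
- apply (is_RInt_derive (V := R_CompleteNormedModule) (fun t => fst (f t)));
    rewrite Rmin_left, Rmax_right by auto; intros t Ht; [apply H, Ht|].
  destruct (Hg t Ht) as [l [H1 H2]].
  apply (ex_derive_continuous (K := R_AbsRing) (V := R_NormedModule)); eexists; eassumption.
- apply (is_RInt_derive (V := R_CompleteNormedModule) (fun t => snd (f t)));
    rewrite Rmin_left, Rmax_right by auto; intros t Ht; [apply H, Ht|].
  destruct (Hg t Ht) as [l [H1 H2]].
  apply (ex_derive_continuous (K := R_AbsRing) (V := R_NormedModule)); eexists; eassumption.
Qed.

(** The mean value theorem gives an intermediate point only for real functions, so it is applied to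
    the two components in turn, and their bounds add up to 2 M. *)
Lemma rder_increment_le (g g' : R -> C) (M : R) :
  (forall t, 0 <= t <= 1 -> rder g t (g' t) /\ Cmod (g' t) <= M) ->
  Cmod (g 1 - g 0)%C <= 2 * M.
Proof.
intros H.
assert (A : forall f f' : R -> R, (forall t, 0 <= t <= 1 -> is_derive f t (f' t) /\ Rabs (f' t) <= M) ->
   Rabs (f 1 - f 0) <= M).
{ intros f f' Hf. destruct (MVT_cor2 f f' 0 1 Rlt_0_1) as [c [E Hc]].
  - intros c Hc. apply is_derive_Reals, Hf, Hc.
  - rewrite E, Rminus_0_r, Rmult_1_r. apply Hf; lra. }
eapply Rle_trans; [apply Cmod_le_Rabs|].
assert (A1 := A (fun t => fst (g t)) (fun t => fst (g' t))).
assert (A2 := A (fun t => snd (g t)) (fun t => snd (g' t))).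
cbn. unfold Rminus in *.
enough (Rabs (fst (g 1) + - fst (g 0)) <= M /\ Rabs (snd (g 1) + - snd (g 0)) <= M) by lra.
split; [apply A1|apply A2]; intros t Ht; destruct (H t Ht) as [[H1 H2] H3]; split; auto.
- eapply Rle_trans; [apply Rabs_fst_le|auto].
- eapply Rle_trans; [apply Rabs_snd_le|auto].
Qed.

Lemma cder_increment_le (f f' : C -> C) (a b : C) (M : R) :
  (forall t, 0 <= t <= 1 -> cder f (a + RtoC t * (b - a))%C (f' (a + RtoC t * (b - a))%C)
     /\ Cmod (f' (a + RtoC t * (b - a))%C) <= M) ->
  Cmod (f b - f a)%C <= 2 * M * Cmod (b - a).
Proof.
intros H.
assert (A := rder_increment_le (fun t => f (a + RtoC t * (b - a)))%C
   (fun t => f' (a + RtoC t * (b - a)) * (b - a))%C (M * Cmod (b - a))).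
cbv beta in A. replace (a + RtoC 1 * (b - a))%C with b in A by ring.
replace (a + RtoC 0 * (b - a))%C with a in A by ring.
rewrite Rmult_assoc. apply A. intros t Ht. destruct (H t Ht) as [H1 H2]. split.
- apply (rder_cder_comp f (fun t => a + RtoC t * (b - a))%C); auto. apply rder_segment.
- rewrite Cmod_mult. apply Rmult_le_compat_r; auto. apply Cmod_ge_0.
Qed.

Lemma RInt_comp_lin_R (g : R -> R) (u v a b : R) :
  ex_RInt g (u * a + v) (u * b + v) ->
  RInt (fun t => u * g (u * t + v)) a b = RInt g (u * a + v) (u * b + v).
Proof. exact (RInt_comp_lin (V := R_CompleteNormedModule) g u v a b). Qed.

Lemma CI_comp_lin (g : R -> C) (u v a b : R) :
  ex_CI g (u * a + v) (u * b + v) ->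
  CI (fun t => RtoC u * g (u * t + v)%R)%C a b = CI g (u * a + v) (u * b + v).
Proof.
intros [H1 H2]. unfold CI.
rewrite <- (RInt_comp_lin_R (fun t => fst (g t))), <- (RInt_comp_lin_R (fun t => snd (g t))) by auto.
f_equal; apply RInt_ext; intros t _; cbn; ring.
Qed.

(** * Goursat's lemma and primitives *)

Definition seg_int (f : C -> C) (u v : C) : C :=
  CI (fun t => f (u + RtoC t * (v - u)) * (v - u))%C 0 1.

Definition cball (z0 : C) (r : R) (z : C) : Prop := Cmod (z - z0) <= r.

Lemma cball_segment (z0 u v : C) (r t : R) :
  cball z0 r u -> cball z0 r v -> 0 <= t <= 1 -> cball z0 r (u + RtoC t * (v - u))%C.
Proof.
unfold cball; intros Hu Hv Ht.
replace (u + RtoC t * (v - u) - z0)%C with (RtoC (1 - t) * (u - z0) + RtoC t * (v - z0))%C.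
2:{ rewrite RtoC_minus; ring. }
eapply Rle_trans; [apply Cmod_triangle|].
rewrite !Cmod_mult, !Cmod_R, !Rabs_pos_eq by lra.
replace r with ((1 - t) * r + t * r) by ring.
apply Rplus_le_compat; apply Rmult_le_compat_l; lra.
Qed.

Lemma rdiff_segment_comp (f : C -> C) (u v : C) (t : R) :
  (exists l, cder f (u + RtoC t * (v - u))%C l) ->
  rdiff (fun t => f (u + RtoC t * (v - u)) * (v - u))%C t.
Proof.
intros [l Hl]. apply rdiff_mult; [|apply rdiff_const].
apply (rdiff_cder_comp f (fun t => u + RtoC t * (v - u))%C t l Hl). apply rdiff_segment.
Qed.

Definition holo_seg (f : C -> C) (u v : C) : Prop :=
  forall t, 0 <= t <= 1 -> exists l, cder f (u + RtoC t * (v - u))%C l.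

Lemma ex_seg_int (f : C -> C) (u v : C) (a b : R) : holo_seg f u v -> 0 <= a <= b -> b <= 1 ->
  ex_CI (fun t => f (u + RtoC t * (v - u)) * (v - u))%C a b.
Proof.
intros H Ha Hb. apply ex_CI_rdiff; [lra|]. intros t Ht. apply rdiff_segment_comp, H; lra.
Qed.

Lemma ex_CI_swap (g : R -> C) (a b : R) : ex_CI g a b -> ex_CI g b a.
Proof. intros [H1 H2]; split; now apply ex_RInt_swap. Qed.

Lemma CI_swap (g : R -> C) (a b : R) : ex_CI g a b -> CI g b a = (- CI g a b)%C.
Proof.
intros [H1 H2]. unfold CI, Copp; cbn [fst snd].
f_equal; symmetry; now apply (opp_RInt_swap (V := R_CompleteNormedModule)).
Qed.

Lemma CI_Chasles (g : R -> C) (a b c : R) :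
  ex_CI g a b -> ex_CI g b c -> (CI g a b + CI g b c)%C = CI g a c.
Proof.
intros [H1 H2] [H3 H4]. apply injective_projections; cbn; now apply (RInt_Chasles (V := R_CompleteNormedModule)).
Qed.

Lemma seg_int_swap (f : C -> C) (u v : C) :
  holo_seg f u v -> seg_int f v u = (- seg_int f u v)%C.
Proof.
intros H. unfold seg_int.
set (g := fun t => (f (u + RtoC t * (v - u)) * (v - u))%C).
assert (E : ex_CI g 0 1) by (apply ex_seg_int; auto; lra).
rewrite <- CI_swap by auto.
transitivity (CI (fun t => RtoC (-1) * g (-1 * t + 1)%R)%C 0 1).
- apply CI_ext; [lra|]. intros t Ht. unfold g.
  rewrite RtoC_plus, RtoC_mult.
  replace (u + (RtoC (-1) * RtoC t + 1) * (v - u))%C with (v + RtoC t * (u - v))%C.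
  + replace (RtoC (-1)) with (- (1))%C by (now rewrite <- RtoC_opp). ring.
  + replace (RtoC (-1)) with (- (1))%C by (now rewrite <- RtoC_opp). ring.
- rewrite CI_comp_lin; rewrite Rmult_0_r, Rplus_0_l, Rmult_1_r;
    replace (-1 + 1) with 0 by ring; auto using ex_CI_swap.
Qed.

(** Written as the point t = 1/2 of the segment parametrisation, so that convexity of discs and the
    splitting of [seg_int] apply to it directly. *)
Definition midpoint (u v : C) : C := (u + RtoC (1 / 2) * (v - u))%C.

Lemma half_half : (RtoC (1 / 2) + RtoC (1 / 2))%C = 1%C.
Proof. rewrite <- RtoC_plus. f_equal. lra. Qed.

Lemma midpoint_comm (u v : C) : midpoint u v = midpoint v u.
Proof.
unfold midpoint. replace v with (1 * v)%C at 2 by ring. replace u with (1 * u)%C at 1 by ring.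
rewrite <- half_half. ring.
Qed.

Lemma seg_int_midpoint (f : C -> C) (u v : C) :
  holo_seg f u v ->
  seg_int f u v = (seg_int f u (midpoint u v) + seg_int f (midpoint u v) v)%C.
Proof.
intros H. unfold seg_int at 1.
set (g := fun t => (f (u + RtoC t * (v - u)) * (v - u))%C).
assert (E1 : ex_CI g 0 (1 / 2)) by (apply ex_seg_int; auto; lra).
assert (E2 : ex_CI g (1 / 2) 1) by (apply ex_seg_int; auto; lra).
rewrite <- (CI_Chasles g 0 (1 / 2) 1) by auto. f_equal.
- transitivity (CI g (1 / 2 * 0 + 0) (1 / 2 * 1 + 0)); [f_equal; lra|].
  rewrite <- CI_comp_lin.
  2:{ replace (1 / 2 * 0 + 0) with 0 by lra. replace (1 / 2 * 1 + 0) with (1 / 2) by lra. auto. }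
  apply CI_ext; [lra|]. intros t Ht. unfold g, midpoint.
  rewrite RtoC_plus, RtoC_mult.
  replace (u + (RtoC (1 / 2) * RtoC t + RtoC 0) * (v - u))%C with
    (u + RtoC t * (u + RtoC (1 / 2) * (v - u) - u))%C by ring. ring.
- transitivity (CI g (1 / 2 * 0 + 1 / 2) (1 / 2 * 1 + 1 / 2)); [f_equal; lra|].
  rewrite <- CI_comp_lin.
  2:{ replace (1 / 2 * 0 + 1 / 2) with (1 / 2) by lra. replace (1 / 2 * 1 + 1 / 2) with 1 by lra. auto. }
  apply CI_ext; [lra|]. intros t Ht. unfold g.
  rewrite RtoC_plus, RtoC_mult.
  assert (M : (v - midpoint u v = RtoC (1 / 2) * (v - u))%C).
  { unfold midpoint. replace (v - (u + RtoC (1 / 2) * (v - u)))%C with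
      (1 * (v - u) - RtoC (1 / 2) * (v - u))%C by ring.
    rewrite <- half_half at 1. ring. }
  rewrite M. unfold midpoint.
  replace (u + RtoC (1 / 2) * (v - u) + RtoC t * (RtoC (1 / 2) * (v - u)))%C with
    (u + (RtoC (1 / 2) * RtoC t + RtoC (1 / 2)) * (v - u))%C by ring. ring.
Qed.

(** * Bisection of triangles *)

Definition triangle_int (f : C -> C) (a b c : C) : C :=
  (seg_int f a b + seg_int f b c + seg_int f c a)%C.

Definition triangle : Type := (C * C * C)%type.
Definition tri_int (f : C -> C) (T : triangle) : C :=
  let '(a, b, c) := T in triangle_int f a b c.
(** All four pieces keep the orientation of T: every inner edge is run in one direction by a corner
    triangle and in the other by the central [sub4], so the inner edges cancel in the sum. *)
Definition sub1 (T : triangle) : triangle :=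
  let '(a, b, c) := T in (a, midpoint a b, midpoint c a).
Definition sub2 (T : triangle) : triangle :=
  let '(a, b, c) := T in (midpoint a b, b, midpoint b c).
Definition sub3 (T : triangle) : triangle :=
  let '(a, b, c) := T in (midpoint c a, midpoint b c, c).
Definition sub4 (T : triangle) : triangle :=
  let '(a, b, c) := T in (midpoint b c, midpoint c a, midpoint a b).

Definition tri_in (D : C -> Prop) (T : triangle) : Prop :=
  let '(a, b, c) := T in D a /\ D b /\ D c.

Definition tri_size (L : R) (T : triangle) : Prop :=
  let '(a, b, c) := T in Cmod (b - a) <= L /\ Cmod (c - b) <= L /\ Cmod (a - c) <= L.

Definition holo_cball (f : C -> C) (z0 : C) (r : R) : Prop :=
  forall z, cball z0 r z -> exists l, cder f z l.

Lemma holo_cball_seg (f : C -> C) (z0 : C) (r : R) (u v : C) :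
  holo_cball f z0 r -> cball z0 r u -> cball z0 r v -> holo_seg f u v.
Proof. intros H Hu Hv t Ht. apply H, cball_segment; auto. Qed.

Lemma cball_midpoint (z0 u v : C) (r : R) :
  cball z0 r u -> cball z0 r v -> cball z0 r (midpoint u v).
Proof. intros Hu Hv; apply cball_segment; auto; lra. Qed.

Lemma tri_int_sub (f : C -> C) (z0 : C) (r : R) (T : triangle) :
  holo_cball f z0 r -> tri_in (cball z0 r) T ->
  tri_int f T = (tri_int f (sub1 T) + tri_int f (sub2 T) + tri_int f (sub3 T) + tri_int f (sub4 T))%C.
Proof.
destruct T as [[a b] c]; cbn. intros Hf [Ha [Hb Hc]].
assert (Hm : forall u v, cball z0 r u -> cball z0 r v -> cball z0 r (midpoint u v))
  by (intros; now apply cball_midpoint).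
assert (Hs : forall u v, cball z0 r u -> cball z0 r v -> holo_seg f u v)
  by (intros; eapply holo_cball_seg; eauto).
unfold triangle_int.
rewrite (seg_int_midpoint f a b), (seg_int_midpoint f b c), (seg_int_midpoint f c a) by auto.
rewrite (seg_int_swap f (midpoint a b) (midpoint c a)) by auto.
rewrite (seg_int_swap f (midpoint a b) (midpoint b c)) by auto.
rewrite (seg_int_swap f (midpoint b c) (midpoint c a)) by auto.
ring.
Qed.

Lemma Cmod_half (z : C) (L : R) : Cmod z <= L -> Cmod (RtoC (1 / 2) * z) <= L / 2.
Proof. intros H. rewrite Cmod_mult, Cmod_R, Rabs_pos_eq; lra. Qed.

Lemma midpoint_sub (u v : C) : (midpoint u v - u = RtoC (1 / 2) * (v - u))%C.
Proof. unfold midpoint; ring. Qed.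

Lemma midpoint_sub_r (u v : C) : (v - midpoint u v = RtoC (1 / 2) * (v - u))%C.
Proof.
replace v with (u + 1 * (v - u))%C at 1 by ring. unfold midpoint. rewrite <- half_half; ring.
Qed.

Lemma midpoint_sub_midpoint (u v w : C) : (midpoint v w - midpoint u v = RtoC (1 / 2) * (w - u))%C.
Proof.
rewrite (midpoint_comm u v). unfold midpoint; ring.
Qed.

(** Every side of a piece is half of a side of T. The bound on the displacement of the first vertex
    is what makes the first vertices of nested triangles converge. *)
Lemma tri_sub_bounds (z0 : C) (r L : R) (T T' : triangle) :
  T' = sub1 T \/ T' = sub2 T \/ T' = sub3 T \/ T' = sub4 T ->
  tri_in (cball z0 r) T -> tri_size L T ->
  tri_in (cball z0 r) T' /\ tri_size (L / 2) T' /\ Cmod (fst (fst T') - fst (fst T)) <= L.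
Proof.
destruct T as [[a b] c]. intros HT' [Ha [Hb Hc]] [Lab [Lbc Lca]].
assert (L0 : 0 <= L) by (eapply Rle_trans; [apply Cmod_ge_0|apply Lab]).
assert (Hm : forall u v, cball z0 r u -> cball z0 r v -> cball z0 r (midpoint u v))
  by (intros; now apply cball_midpoint).
assert (Hab := Cmod_half _ _ Lab). assert (Hbc := Cmod_half _ _ Lbc). assert (Hca := Cmod_half _ _ Lca).
destruct HT' as [-> | [-> | [-> | ->]]]; cbn; (split; [auto|split]).
- rewrite midpoint_sub, midpoint_sub_r, (midpoint_comm a b), (midpoint_comm c a), midpoint_sub_midpoint.
  auto using Cmod_half.
- replace (a - a)%C with (RtoC 0) by ring. rewrite Cmod_0; auto.
- rewrite midpoint_sub, midpoint_sub_r, (midpoint_comm a b), (midpoint_comm b c), midpoint_sub_midpoint.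
  auto using Cmod_half.
- rewrite midpoint_sub; lra.
- rewrite midpoint_sub, midpoint_sub_r, (midpoint_comm b c), (midpoint_comm c a), midpoint_sub_midpoint.
  auto using Cmod_half.
- rewrite midpoint_comm, midpoint_sub, Cmod_mult, Cmod_R, Rabs_pos_eq by lra.
  rewrite (Cmod_sub_sym c a); lra.
- rewrite !midpoint_sub_midpoint.
  rewrite (Cmod_sub_sym b a) in Lab. rewrite (Cmod_sub_sym c b) in Lbc. rewrite (Cmod_sub_sym a c) in Lca.
  auto using Cmod_half.
(* The first vertex of [sub4] is the midpoint of b and c, both of which lie in the disc of radius L
   about a. *)
- apply (cball_midpoint a b c L); unfold cball; auto. now rewrite Cmod_sub_sym.
Qed.

(** Not a true maximum: the first piece carrying at least a quarter of |integral| is taken, and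
    [sub4] by default. If the other three fall short, the triangle inequality forces [sub4] to
    qualify. Deciding real inequalities makes this a function, so the nested sequence is a plain
    recursion. *)
Definition largest_sub (f : C -> C) (T : triangle) : triangle :=
  let large T' := Rle_dec (Cmod (tri_int f T) / 4) (Cmod (tri_int f T')) in
  if large (sub1 T) then sub1 T
  else if large (sub2 T) then sub2 T
  else if large (sub3 T) then sub3 T
  else sub4 T.

Lemma largest_sub_cases (f : C -> C) (T : triangle) :
  let T' := largest_sub f T in T' = sub1 T \/ T' = sub2 T \/ T' = sub3 T \/ T' = sub4 T.
Proof. cbv zeta. unfold largest_sub. repeat destruct Rle_dec; auto. Qed.

Lemma largest_sub_int (f : C -> C) (z0 : C) (r : R) (T : triangle) :
  holo_cball f z0 r -> tri_in (cball z0 r) T ->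
  Cmod (tri_int f T) <= 4 * Cmod (tri_int f (largest_sub f T)).
Proof.
intros Hf HT. unfold largest_sub.
destruct Rle_dec as [H1|H1]; [lra|].
destruct Rle_dec as [H2|H2]; [lra|].
destruct Rle_dec as [H3|H3]; [lra|].
assert (E := tri_int_sub f z0 r T Hf HT).
apply (f_equal Cmod) in E.
assert (Cmod (tri_int f T) <= Cmod (tri_int f (sub1 T)) + Cmod (tri_int f (sub2 T))
   + Cmod (tri_int f (sub3 T)) + Cmod (tri_int f (sub4 T))).
{ rewrite E. eapply Rle_trans; [apply Cmod_triangle|]. apply Rplus_le_compat_r.
  eapply Rle_trans; [apply Cmod_triangle|]. apply Rplus_le_compat_r. apply Cmod_triangle. }
lra.
Qed.

Fixpoint nested (f : C -> C) (T : triangle) (n : nat) : triangle :=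
  match n with O => T | S m => largest_sub f (nested f T m) end.

Lemma nested_spec (f : C -> C) (z0 : C) (r L : R) (T : triangle) (n : nat) :
  holo_cball f z0 r -> tri_in (cball z0 r) T -> tri_size L T ->
  tri_in (cball z0 r) (nested f T n) /\ tri_size (L / 2 ^ n) (nested f T n) /\
  Cmod (tri_int f T) <= 4 ^ n * Cmod (tri_int f (nested f T n)) /\
  Cmod (fst (fst (nested f T (S n))) - fst (fst (nested f T n))) <= L / 2 ^ n.
Proof.
intros Hf HT HL.
assert (A : tri_in (cball z0 r) (nested f T n) /\ tri_size (L / 2 ^ n) (nested f T n) /\
  Cmod (tri_int f T) <= 4 ^ n * Cmod (tri_int f (nested f T n))).
{ induction n as [|n [I1 [I2 I3]]].
  - simpl. rewrite Rdiv_1_r, Rmult_1_l. repeat split; auto. apply Rle_refl.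
  - destruct (tri_sub_bounds z0 r (L / 2 ^ n) _ _ (largest_sub_cases f (nested f T n)) I1 I2) as [J1 [J2 J3]].
    simpl. repeat split; auto.
    + replace (L / (2 * 2 ^ n)) with (L / 2 ^ n / 2); auto. field. apply pow_nonzero; lra.
    + eapply Rle_trans; [apply I3|].
      rewrite (Rmult_comm 4), Rmult_assoc. apply Rmult_le_compat_l; [apply pow_le; lra|].
      now apply (largest_sub_int f z0 r). }
destruct A as [A1 [A2 A3]]. repeat split; auto.
simpl. apply (tri_sub_bounds z0 r (L / 2 ^ n) _ _ (largest_sub_cases f (nested f T n)) A1 A2).
Qed.

(** The radius 2 L / 2^n is the sum of all later steps, so the intervals from [lo n] to [hi n] are
    nested; l is the supremum of the left endpoints. *)
Lemma geometric_limit (x : nat -> R) (L : R) :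
  (forall n, Rabs (x (S n) - x n) <= L / 2 ^ n) ->
  exists l, forall n, Rabs (l - x n) <= 2 * L / 2 ^ n.
Proof.
intros H.
set (lo := fun n => x n - 2 * L / 2 ^ n). set (hi := fun n => x n + 2 * L / 2 ^ n).
assert (P : forall n, 2 ^ n <> 0) by (intros; apply pow_nonzero; lra).
assert (E : forall n, 2 * L / 2 ^ S n = L / 2 ^ n) by (intros; simpl; field; auto).
assert (D : forall n, 2 * L / 2 ^ n = L / 2 ^ n + L / 2 ^ n) by (intros; field; auto).
assert (Lo : forall n, lo n <= lo (S n)).
{ intros n; unfold lo; rewrite E, D; specialize (H n); apply Rabs_le_between in H; lra. }
assert (Hi : forall n, hi (S n) <= hi n).
{ intros n; unfold hi; rewrite E, D; specialize (H n); apply Rabs_le_between in H; lra. }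
assert (LL : forall n, 0 <= 2 * L / 2 ^ n).
{ intros n. rewrite D. pose proof (Rle_trans _ _ _ (Rabs_pos _) (H n)). lra. }
assert (Lo' : forall n k, lo n <= lo (n + k)%nat).
{ intros n k; induction k; [rewrite Nat.add_0_r; lra|rewrite Nat.add_succ_r; eapply Rle_trans; eauto]. }
assert (Hi' : forall n k, hi (n + k)%nat <= hi n).
{ intros n k; induction k; [rewrite Nat.add_0_r; lra|rewrite Nat.add_succ_r; eapply Rle_trans; eauto]. }
assert (LH : forall n m, lo n <= hi m).
{ intros n m. apply Rle_trans with (lo (n + m)%nat); auto.
  apply Rle_trans with (hi (m + n)%nat); auto. rewrite Nat.add_comm.
  unfold lo, hi. specialize (LL (m + n)%nat). lra. }
destruct (completeness (fun y => exists n, y = lo n)) as [l [U V]].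
- exists (hi O). intros y [n ->]; auto.
- exists (lo O), O; auto.
- exists l. intros n. apply Rabs_le_between.
  assert (lo n <= l) by (apply U; now exists n).
  assert (l <= hi n) by (apply V; intros y [m ->]; auto).
  unfold lo, hi in *; lra.
Qed.

Lemma C_geometric_limit (x : nat -> C) (L : R) :
  (forall n, Cmod (x (S n) - x n) <= L / 2 ^ n) ->
  exists l, forall n, Cmod (l - x n) <= 4 * L / 2 ^ n.
Proof.
intros H.
destruct (geometric_limit (fun n => fst (x n)) L) as [l1 H1].
{ intros n. eapply Rle_trans; [apply (Rabs_fst_le (x (S n) - x n))|apply H]. }
destruct (geometric_limit (fun n => snd (x n)) L) as [l2 H2].
{ intros n. eapply Rle_trans; [apply (Rabs_snd_le (x (S n) - x n))|apply H]. }
exists (l1, l2). intros n. eapply Rle_trans; [apply Cmod_le_Rabs|].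
specialize (H1 n). specialize (H2 n). cbn. unfold Rminus, Rdiv in *. lra.
Qed.

(** Comes from the explicit primitive l z^2 / 2 + c z; around a triangle these differences telescope
    to zero. *)
Lemma seg_int_affine (l c u v : C) :
  seg_int (fun z => l * z + c)%C u v =
  ((l * v * v / 2 + c * v) - (l * u * u / 2 + c * u))%C.
Proof.
unfold seg_int.
rewrite (CI_rder (fun t => let z := (u + RtoC t * (v - u)) in l * z * z / 2 + c * z)%C).
- cbv zeta. replace (u + RtoC 1 * (v - u))%C with v by ring.
  replace (u + RtoC 0 * (v - u))%C with u by ring. reflexivity.
- lra.
- intros t _. cbv zeta.
  eapply rder_ext; [reflexivity| |].
  2:{ apply rder_plus.
      - apply rder_mult; [|apply rder_const].
        apply rder_mult; [apply rder_mult; [apply rder_const|apply rder_segment]|apply rder_segment].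
      - apply rder_mult; [apply rder_const|apply rder_segment]. }
  cbv beta. field.
- intros t _. apply rdiff_mult; [|apply rdiff_const].
  apply rdiff_plus; [|apply rdiff_const]. apply rdiff_mult; [apply rdiff_const|apply rdiff_segment].
Qed.

(** Compares f with its tangent map in [Goursat], and with a constant (slope 0) in
    [exists_primitive]. *)
Lemma seg_int_near_affine (f : C -> C) (u v l c : C) (M : R) :
  holo_seg f u v ->
  (forall t, 0 <= t <= 1 -> let z := (u + RtoC t * (v - u))%C in Cmod (f z - (l * z + c))%C <= M) ->
  Cmod (seg_int f u v - seg_int (fun z => l * z + c)%C u v) <= 2 * M * Cmod (v - u).
Proof.
intros Hf HM. unfold seg_int.
assert (Ex : ex_CI (fun t => (l * (u + RtoC t * (v - u)) + c) * (v - u))%C 0 1).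
{ apply ex_CI_rdiff; [lra|]. intros t _. apply rdiff_mult; [|apply rdiff_const].
  apply rdiff_plus; [|apply rdiff_const]. apply rdiff_mult; [apply rdiff_const|apply rdiff_segment]. }
assert (Ex2 : ex_CI (fun t => f (u + RtoC t * (v - u)) * (v - u))%C 0 1) by (apply ex_seg_int; auto; lra).
rewrite <- CI_minus by auto.
replace (2 * M * Cmod (v - u)) with (2 * (M * Cmod (v - u)) * (1 - 0)) by ring.
apply Cmod_CI_le; [lra| |].
- apply ex_CI_rdiff; [lra|]. intros t Ht. apply rdiff_minus.
  + apply rdiff_segment_comp; auto.
  + apply rdiff_mult; [|apply rdiff_const].
    apply rdiff_plus; [|apply rdiff_const]. apply rdiff_mult; [apply rdiff_const|apply rdiff_segment].
- intros t Ht. specialize (HM t Ht). cbv zeta in HM.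
  replace (f (u + RtoC t * (v - u)) * (v - u) - (l * (u + RtoC t * (v - u)) + c) * (v - u))%C
    with ((f (u + RtoC t * (v - u)) - (l * (u + RtoC t * (v - u)) + c)) * (v - u))%C by ring.
  rewrite Cmod_mult. apply Rmult_le_compat_r; auto. apply Cmod_ge_0.
Qed.

Lemma exists_pow2_small (K d : R) : 0 <= K -> 0 < d -> exists n, K / 2 ^ n < d.
Proof.
intros HK Hd.
destruct (pow_lt_1_zero (1 / 2) (ltac:(rewrite Rabs_pos_eq; lra)) (d / (K + 1))) as [n Hn].
{ apply Rdiv_lt_0_compat; lra. }
exists n. specialize (Hn n (le_n n)). rewrite Rabs_pos_eq in Hn by (apply pow_le; lra).
assert (P : 0 < 2 ^ n) by (apply pow_lt; lra).
replace ((1 / 2) ^ n) with (/ 2 ^ n) in Hn.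
2:{ rewrite <- pow_inv. f_equal. lra. }
assert (0 < / 2 ^ n) by now apply Rinv_0_lt_compat.
apply Rle_lt_trans with ((K + 1) * / 2 ^ n); [unfold Rdiv; nra|].
replace d with ((K + 1) * (d / (K + 1))) by (field; lra).
apply Rmult_lt_compat_l; lra.
Qed.

(** Near the limit point p, f is within e |z - p| of an affine map, whose triangle integral
    vanishes. The integral over the n-th triangle is thus of order e (L / 2^n)^2, which absorbs the
    factor 4^n lost in n bisections. *)
Lemma Goursat (f : C -> C) (z0 : C) (r r' : R) (T : triangle) :
  r < r' -> holo_cball f z0 r' -> tri_in (cball z0 r) T -> tri_int f T = 0.
Proof.
intros Hr Hf' HT.
assert (Hf : holo_cball f z0 r) by (intros z Hz; apply Hf'; unfold cball in *; lra).
assert (HL : exists L, 0 <= L /\ tri_size L T).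
{ destruct T as [[a b] c]. exists (Cmod (b - a) + Cmod (c - b) + Cmod (a - c)).
  pose proof (Cmod_ge_0 (b - a)). pose proof (Cmod_ge_0 (c - b)). pose proof (Cmod_ge_0 (a - c)).
  cbn; lra. }
destruct HL as [L [L0 HL]].
assert (Hn := fun n => nested_spec f z0 r L T n Hf HT HL).
destruct (C_geometric_limit (fun n => fst (fst (nested f T n))) L) as [p Hp]; [intros n; apply Hn|].
cbv beta in Hp.
(* The point p lies within 4 L / 2^n of a vertex in the disc of radius r, for every n. The margin r'
   - r puts p in the larger disc without a closedness argument. *)
assert (Pp : cball z0 r' p).
{ destruct (exists_pow2_small (4 * L) (r' - r)) as [n Hs]; [lra|lra|].
  specialize (Hp n). destruct (Hn n) as [A _]. destruct (nested f T n) as [[a b] c].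
  destruct A as [A _]. cbn in Hp. unfold cball in *.
  assert (Q := Cmod_sub_tri p a z0). lra. }
destruct (Hf' p Pp) as [l Hl].
apply Cmod_eq_0, Rle_antisym; [|apply Cmod_ge_0].
apply le_epsilon. intros eps He. rewrite Rplus_0_l.
(* The 30 is three sides times 2 * 5, from the factor 2 of the integral bound and the distance 5 K
   to p; the 1 covers L = 0. *)
assert (He' : 0 < eps / (30 * (L * L) + 1)) by (apply Rdiv_lt_0_compat; nra).
set (e := eps / (30 * (L * L) + 1)) in *.
destruct (proj1 (cder_eps _ _ _) Hl e He') as [d [Pd Hd]].
destruct (exists_pow2_small (5 * L) d) as [n Hs]; [lra|lra|].
destruct (Hn n) as [A1 [A2 [A3 _]]]. specialize (Hp n).
eapply Rle_trans; [apply A3|].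
destruct (nested f T n) as [[a b] c]. cbn in A1, A2, Hp |- *.
destruct A1 as [Ia [Ib Ic]], A2 as [Lab [Lbc Lca]].
assert (P2 : 0 < 2 ^ n) by (apply pow_lt; lra).
set (K := L / 2 ^ n) in *.
replace (4 * L / 2 ^ n) with (4 * K) in Hp by (unfold K; field; lra).
replace (5 * L / 2 ^ n) with (5 * K) in Hs by (unfold K; field; lra).
assert (K0 : 0 <= K) by (eapply Rle_trans; [apply Cmod_ge_0|apply Lab]).
set (q := (f p - l * p)%C).
(* At most 4 K from p to the vertex a, then K from a to z. *)
assert (near : forall z, cball a K z -> Cmod (f z - (l * z + q))%C <= e * (5 * K)).
{ intros z Hz. unfold cball in Hz.
  assert (Hzp : Cmod (z - p) <= 5 * K).
  { assert (Q := Cmod_sub_tri z a p). rewrite (Cmod_sub_sym a p) in Q. lra. }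
  specialize (Hd (z - p)%C). replace (p + (z - p))%C with z in Hd by ring.
  replace (f z - (l * z + q))%C with (f z - f p - (z - p) * l)%C by (unfold q; ring).
  eapply Rle_trans; [apply Hd; lra|]. apply Rmult_le_compat_l; lra. }
assert (Ka : cball a K a) by (unfold cball; replace (a - a)%C with (RtoC 0) by ring; rewrite Cmod_0; lra).
assert (Kc : cball a K c) by (unfold cball; now rewrite Cmod_sub_sym).
assert (side : forall u v, cball z0 r u -> cball z0 r v -> cball a K u -> cball a K v -> Cmod (v - u) <= K ->
  Cmod (seg_int f u v - seg_int (fun z => l * z + q)%C u v) <= 2 * (e * (5 * K)) * K).
{ intros u v Hu Hv Hu' Hv' Huv. eapply Rle_trans; [apply (seg_int_near_affine f u v l q (e * (5 * K)))|].
  - eapply holo_cball_seg; eauto.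
  - intros t Ht; cbv zeta. apply near, cball_segment; auto.
  - apply Rmult_le_compat_l; auto. nra. }
assert (S1 := side a b Ia Ib Ka Lab Lab).
assert (S2 := side b c Ib Ic Lab Kc Lbc).
assert (S3 := side c a Ic Ia Kc Ka Lca).
assert (Bound : Cmod (triangle_int f a b c) <= 30 * e * (K * K)).
{ unfold triangle_int.
  replace (seg_int f a b + seg_int f b c + seg_int f c a)%C with
   ((seg_int f a b - seg_int (fun z => l * z + q) a b) + (seg_int f b c - seg_int (fun z => l * z + q) b c)
    + (seg_int f c a - seg_int (fun z => l * z + q) c a))%C.
  - eapply Rle_trans; [apply Cmod_triangle|].
    eapply Rle_trans; [apply Rplus_le_compat_r, Cmod_triangle|]. lra.
  - rewrite !seg_int_affine. ring. }
apply Rle_trans with (4 ^ n * (30 * e * (K * K))).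
{ apply Rmult_le_compat_l; auto. apply pow_le; lra. }
replace (4 ^ n * (30 * e * (K * K))) with (30 * (L * L) * e).
2:{ unfold K. replace 4 with (2 * 2) by ring. rewrite Rpow_mult_distr. field. lra. }
replace eps with ((30 * (L * L) + 1) * e) by (unfold e; field; nra).
apply Rmult_le_compat_r; lra.
Qed.

(** The primitive is the integral from the centre. [Goursat] on the triangle z0, z, z + h turns its
    increment into the integral over the short segment from z to z + h, where f is within eps / 2 of
    f z. *)
Lemma exists_primitive (f : C -> C) (z0 : C) (r r' : R) :
  r < r' -> holo_cball f z0 r' ->
  exists F, forall z, Cmod (z - z0) < r -> cder F z (f z).
Proof.
intros Hr Hf'. exists (seg_int f z0). intros z Hz.
assert (Hf : holo_cball f z0 r) by (intros y Hy; apply Hf'; unfold cball in *; lra).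
assert (Hzr : cball z0 r z) by (unfold cball; lra).
destruct (Hf z Hzr) as [l Hl].
apply cder_eps. intros eps He.
destruct (cder_continuous f z l (eps / 2) Hl) as [d [Pd Hd]]; [lra|].
exists (Rmin d (r - Cmod (z - z0))); split; [apply Rmin_pos; lra|].
intros h Hh.
assert (Hh1 : Cmod h < d) by (eapply Rlt_le_trans; [apply Hh|apply Rmin_l]).
assert (Hh2 : Cmod h < r - Cmod (z - z0)) by (eapply Rlt_le_trans; [apply Hh|apply Rmin_r]).
assert (Hzh : cball z0 r (z + h)%C).
{ unfold cball. replace (z + h - z0)%C with ((z - z0) + h)%C by ring.
  eapply Rle_trans; [apply Cmod_triangle|]. lra. }
assert (Hz0 : cball z0 r z0).
{ unfold cball. replace (z0 - z0)%C with (RtoC 0) by ring. rewrite Cmod_0.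
  pose proof (Cmod_ge_0 (z - z0)). lra. }
assert (G := Goursat f z0 r r' (z0, z, z + h)%C Hr Hf' (conj Hz0 (conj Hzr Hzh))).
cbn in G. unfold triangle_int in G.
rewrite (seg_int_swap f z0 (z + h)) in G by (eapply holo_cball_seg; eauto).
replace (seg_int f z0 (z + h) - seg_int f z0 z - h * f z)%C with (seg_int f z (z + h) - h * f z)%C.
2:{ replace (seg_int f z (z + h)) with
     (seg_int f z0 (z + h) - seg_int f z0 z + (seg_int f z0 z + seg_int f z (z + h) + - seg_int f z0 (z + h)))%C by ring.
    rewrite G. ring. }
assert (N := seg_int_near_affine f z (z + h) 0 (f z) (eps / 2)).
rewrite seg_int_affine in N.
replace (0 * (z + h) * (z + h) / 2 + f z * (z + h) - (0 * z * z / 2 + f z * z))%C with (h * f z)%C in N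
  by (unfold Cdiv; ring).
replace (z + h - z)%C with h in N by ring.
eapply Rle_trans; [apply N|right; field].
- eapply holo_cball_seg; eauto.
- intros t Ht; cbv zeta.
  replace (f (z + RtoC t * h) - (0 * (z + RtoC t * h) + f z))%C with (f (z + RtoC t * h) - f z)%C by ring.
  apply Hd. rewrite Cmod_mult, Cmod_R, Rabs_pos_eq by lra.
  pose proof (Cmod_ge_0 h). nra.
Qed.

Lemma cder_unique (f : C -> C) (z l m : C) : cder f z l -> cder f z m -> l = m.
Proof. intros H1 H2. rewrite <- (is_C_derive_unique f z l H1). exact (is_C_derive_unique f z m H2). Qed.

Lemma cder_ext_ball (f g : C -> C) (z0 z l m : C) (r : R) :
  Cmod (z - z0) < r -> (forall y, Cmod (y - z0) < r -> f y = g y) -> l = m ->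
  cder f z l -> cder g z m.
Proof.
intros Hz E <- H. apply cder_eps. intros eps He.
destruct (proj1 (cder_eps _ _ _) H eps He) as [d [P Hd]].
exists (Rmin d (r - Cmod (z - z0))); split; [apply Rmin_pos; lra|].
intros h Hh. rewrite <- (E z Hz), <- (E (z + h)%C).
- apply Hd. eapply Rlt_le_trans; [apply Hh|apply Rmin_l].
- replace (z + h - z0)%C with ((z - z0) + h)%C by ring.
  eapply Rle_lt_trans; [apply Cmod_triangle|].
  assert (Cmod h < r - Cmod (z - z0)) by (eapply Rlt_le_trans; [apply Hh|apply Rmin_r]). lra.
Qed.

Lemma cder_of_quadratic (f : C -> C) (z l : C) (K d : R) :
  0 < d -> (forall h, Cmod h < d -> Cmod (f (z + h) - f z - h * l)%C <= K * (Cmod h * Cmod h)) ->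
  cder f z l.
Proof.
intros Hd H. apply cder_eps. intros eps He.
set (K' := Rmax K 1).
assert (K' > 0) by (unfold K'; pose proof (Rmax_r K 1); lra).
exists (Rmin d (eps / K')); split.
- apply Rmin_pos; auto. apply Rdiv_lt_0_compat; lra.
- intros h Hh. pose proof (Cmod_ge_0 h).
  assert (Hh1 : Cmod h < d) by (eapply Rlt_le_trans; [apply Hh|apply Rmin_l]).
  assert (Hh2 : Cmod h < eps / K') by (eapply Rlt_le_trans; [apply Hh|apply Rmin_r]).
  eapply Rle_trans; [apply H, Hh1|].
  rewrite <- Rmult_assoc. apply Rmult_le_compat_r; auto.
  apply Rle_trans with (K' * Cmod h); [apply Rmult_le_compat_r; auto; apply Rmax_l|].
  replace eps with (K' * (eps / K')) by (field; lra). apply Rmult_le_compat_l; lra.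
Qed.

Lemma cder_scal (c : C) (f : C -> C) (z l : C) : cder f z l -> cder (fun y => c * f y)%C z (c * l)%C.
Proof.
intros H. apply cder_eps. intros eps He. pose proof (Cmod_ge_0 c).
assert (He' : 0 < eps / (1 + Cmod c)) by (apply Rdiv_lt_0_compat; lra).
destruct (proj1 (cder_eps _ _ _) H _ He') as [d [P Hd]].
exists d; split; auto. intros h Hh. specialize (Hd h Hh).
replace (c * f (z + h) - c * f z - h * (c * l))%C with (c * (f (z + h) - f z - h * l))%C by ring.
rewrite Cmod_mult.
replace (eps * Cmod h) with ((1 + Cmod c) * (eps / (1 + Cmod c) * Cmod h)) by (field; lra).
apply Rmult_le_compat; auto; try lra. apply Cmod_ge_0.
Qed.

(** Cutting [0, 1] into n equal steps bounds the total increment by n * K / n^2 = K / n, for every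
    n. A Taylor estimate can thus be used directly, without computing the derivative of phi. *)
Lemma constant_of_quadratic (phi : R -> C) (K : R) :
  (forall t s, 0 <= t <= 1 -> 0 <= s <= 1 -> Cmod (phi s - phi t)%C <= K * (s - t) ^ 2) ->
  phi 1 = phi 0.
Proof.
intros H.
assert (K0 : 0 <= K).
{ assert (Q := H 0 1 (ltac:(lra)) (ltac:(lra))). pose proof (Cmod_ge_0 (phi 1 - phi 0)). lra. }
assert (A : forall n, (0 < n)%nat -> Cmod (phi 1 - phi 0) <= K / INR n).
{ intros n Hn. assert (Pn : 0 < INR n) by now apply lt_0_INR.
  assert (B : forall k, (k <= n)%nat -> Cmod (phi (INR k / INR n)%R - phi 0) <= INR k * (K / INR n ^ 2)).
  { induction k; intros Hk.
    - simpl INR. unfold Rdiv at 1. rewrite Rmult_0_l.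
      replace (phi 0 - phi 0)%C with (RtoC 0) by ring. rewrite Cmod_0; lra.
    - assert (Hk' : 0 <= INR k / INR n <= 1 /\ 0 <= INR (S k) / INR n <= 1).
      { assert (INR k <= INR n) by (apply le_INR; lia).
        assert (INR (S k) <= INR n) by (apply le_INR; lia).
        pose proof (pos_INR k). pose proof (pos_INR (S k)).
        split; (split; [apply Rmult_le_pos; auto; left; now apply Rinv_0_lt_compat|]);
        apply (Rmult_le_reg_r (INR n)); auto; unfold Rdiv; rewrite Rmult_assoc, Rinv_l; lra. }
      destruct Hk' as [H1 H2]. assert (Q := H _ _ H1 H2).
      assert (Q' := Cmod_sub_tri (phi (INR (S k) / INR n)%R) (phi (INR k / INR n)%R) (phi 0)).
      specialize (IHk (ltac:(lia))).
      replace (INR (S k) * (K / INR n ^ 2)) with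
        (K * (INR (S k) / INR n - INR k / INR n) ^ 2 + INR k * (K / INR n ^ 2)).
      2:{ rewrite S_INR. field. lra. }
      lra. }
  specialize (B n (le_n n)).
  replace (INR n / INR n) with 1 in B by (field; lra).
  replace (K / INR n) with (INR n * (K / INR n ^ 2)) by (field; lra). exact B. }
assert (Z : Cmod (phi 1 - phi 0) = 0).
{ apply Rle_antisym; [|apply Cmod_ge_0]. apply le_epsilon. intros eps He. rewrite Rplus_0_l.
  destruct (INR_unbounded (K / eps)) as [n Hn].
  assert (0 <= K / eps) by (apply Rmult_le_pos; auto; left; now apply Rinv_0_lt_compat).
  assert (0 < INR n) by lra.
  eapply Rle_trans; [apply (A n); now apply INR_lt|].
  apply (Rmult_le_reg_r (INR n)); auto. unfold Rdiv. rewrite Rmult_assoc, Rinv_l, Rmult_1_r by lra.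
  replace K with (K / eps * eps) by (field; lra). nra. }
apply Cmod_eq_0 in Z. replace (phi 1) with ((phi 1 - phi 0) + phi 0)%C by ring. rewrite Z. ring.
Qed.

(** * Cauchy's formula *)

(** Taylor estimate for the Cauchy kernel, uniform in u at distance at least d from 0; u stands for
    w - z and k for the increment of z. With x = 1 / (u - k) and y = 1 / u, the relation x - y = k x
    y makes the remainder of order n + 1 equal to x times that of order n plus (n + 1) k^2 x y^(n +
    2). *)
Lemma pow_inv_quadratic (d : R) (n : nat) : 0 < d ->
  exists K, forall u k, d <= Cmod u -> d <= Cmod (u - k) ->
  Cmod ((/ (u - k)) ^ n - (/ u) ^ n - k * (RtoC (INR n) * (/ u) ^ (S n)))%C <= K * (Cmod k * Cmod k).
Proof.
intros Hd. induction n as [|n [K HK]].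
- exists 0. intros u k _ _. simpl INR.
  replace ((/ (u - k)) ^ 0 - (/ u) ^ 0 - k * (RtoC 0 * (/ u) ^ 1))%C with (RtoC 0) by (cbn [Cpow]; ring).
  rewrite Cmod_0; lra.
(* The n + 3 factors 1 / d bound x y^(n + 2). *)
- exists (/ d * K + INR (S n) * / d ^ (n + 3)). intros u k Hu Huk.
  specialize (HK u k Hu Huk).
  assert (Nu : u <> 0) by (apply Cmod_gt_0; lra).
  assert (Nuk : (u - k)%C <> 0) by (apply Cmod_gt_0; lra).
  assert (Exy : (/ (u - k) - / u - k * / (u - k) * / u)%C = 0) by (field; auto).
  assert (Bx : Cmod (/ (u - k)) <= / d) by (rewrite Cmod_inv by auto; apply Rinv_le_contravar; lra).
  assert (By : Cmod (/ u) <= / d) by (rewrite Cmod_inv by auto; apply Rinv_le_contravar; lra).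
  set (x := (/ (u - k))%C) in *. set (y := (/ u)%C) in *.
  rewrite S_INR, RtoC_plus in *. cbn [Cpow] in HK |- *. set (X := (x ^ n)%C) in *.
  replace (x * X - y * y ^ n - k * ((RtoC (INR n) + 1) * (y * (y * y ^ n))))%C with
    (x * (X - y ^ n - k * (RtoC (INR n) * (y * y ^ n)))
     + (RtoC (INR n) + 1) * (k * k * (x * (y * (y * y ^ n)))))%C.
  2:{ transitivity (x * (X - y ^ n - k * (RtoC (INR n) * (y * y ^ n))) + (RtoC (INR n) + 1) * (k * y * y ^ n) * (x - y)
        - (RtoC (INR n) + 1) * (k * y * y ^ n) * (x - y - k * x * y))%C; [ring|].
      transitivity (x * (X - y ^ n - k * (RtoC (INR n) * (y * y ^ n))) + (RtoC (INR n) + 1) * (k * y * y ^ n) * (x - y)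
        + y ^ n * (x - y - k * x * y))%C; [rewrite Exy; ring|ring]. }
  eapply Rle_trans; [apply Cmod_triangle|].
  rewrite Rmult_plus_distr_r. apply Rplus_le_compat.
  + rewrite Cmod_mult, Rmult_assoc. apply Rmult_le_compat; auto using Cmod_ge_0.
  + rewrite <- RtoC_plus, !Cmod_mult, Cmod_R, Cmod_pow.
    pose proof (pos_INR n). rewrite Rabs_pos_eq by lra.
    replace (n + 3)%nat with (S (S (S n))) by lia.
    replace (/ d ^ S (S (S n))) with (/ d * (/ d * (/ d * (/ d) ^ n))).
    2:{ rewrite pow_inv; simpl; field. split; [apply pow_nonzero|]; lra. }
    rewrite (Rmult_assoc (INR n + 1)). apply Rmult_le_compat_l; [lra|].
    rewrite (Rmult_comm (Cmod k * Cmod k)). pose proof (Cmod_ge_0 k). pose proof (Cmod_ge_0 x). pose proof (Cmod_ge_0 y).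
    assert (0 <= Cmod y ^ n) by now apply pow_le.
    assert (Cmod y ^ n <= (/ d) ^ n) by now apply pow_incr.
    apply Rmult_le_compat_r; [now apply Rmult_le_pos|].
    repeat (apply Rmult_le_compat; auto; repeat apply Rmult_le_pos; auto).
Qed.

(** * Circles and Cauchy integrals *)

Definition circ (z0 : C) (r : R) (th : R) : C := (z0 + RtoC r * (cos th, sin th))%C.
Definition circ' (r : R) (th : R) : C := (RtoC r * ((- sin th)%R, cos th))%C.

Lemma rder_cos_sin (th : R) : rder (fun t => (cos t, sin t)) th ((- sin th)%R, cos th).
Proof. split; [apply is_derive_cos|apply is_derive_sin]. Qed.

Lemma rder_circ (z0 : C) (r th : R) : rder (circ z0 r) th (circ' r th).
Proof.
eapply rder_ext; [reflexivity| |apply rder_plus; [apply rder_const|apply rder_mult; [apply rder_const|apply rder_cos_sin]]].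
unfold circ'. cbv beta. ring.
Qed.

Lemma rdiff_circ (z0 : C) (r th : R) : rdiff (circ z0 r) th.
Proof. eexists; apply rder_circ. Qed.

Lemma rdiff_circ' (r th : R) : rdiff (circ' r) th.
Proof.
apply rdiff_mult; [apply rdiff_const|]. exists (- cos th, - sin th). split; [|apply is_derive_cos].
apply (is_derive_opp (V := R_NormedModule)). apply is_derive_sin.
Qed.

Lemma Cmod_unit (th : R) : Cmod (cos th, sin th) = 1.
Proof.
unfold Cmod; cbn [fst snd]. rewrite <- sqrt_1. f_equal.
rewrite <- (sin2_cos2 th). unfold Rsqr. ring.
Qed.

Lemma Cmod_circ (z0 : C) (r th : R) : 0 <= r -> Cmod (circ z0 r th - z0) = r.
Proof.
intros Hr. unfold circ. replace (z0 + RtoC r * (cos th, sin th) - z0)%C with (RtoC r * (cos th, sin th))%C by ring.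
rewrite Cmod_mult, Cmod_unit, Cmod_R, Rabs_pos_eq; lra.
Qed.

Lemma circ'_eq (z0 : C) (r th : R) : circ' r th = (Ci * (circ z0 r th - z0))%C.
Proof. unfold circ, circ', Ci, Cminus, Cplus, Copp, Cmult, RtoC; cbn; f_equal; ring. Qed.

Lemma Cmod_circ' (r th : R) : 0 <= r -> Cmod (circ' r th) = r.
Proof. intros Hr. rewrite (circ'_eq 0), Cmod_mult, Cmod_Ci, Cmod_circ; lra. Qed.

Lemma circ_2PI (z0 : C) (r : R) : circ z0 r (2 * PI) = circ z0 r 0.
Proof. unfold circ. now rewrite cos_2PI, sin_2PI, cos_0, sin_0. Qed.

(** The reason for working on the half disc: there the distance to the circle is at least r / 2,
    which bounds the kernel uniformly. *)
Lemma circ_dist (z0 z : C) (r th : R) : Cmod (z - z0) < r / 2 -> r / 2 <= Cmod (circ z0 r th - z).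
Proof.
intros Hz. assert (Q := Cmod_sub_tri (circ z0 r th) z z0).
pose proof (Cmod_ge_0 (z - z0)). rewrite Cmod_circ in Q by lra. lra.
Qed.

Lemma circ_neq (z0 z : C) (r th : R) : Cmod (z - z0) < r / 2 -> (circ z0 r th - z)%C <> 0.
Proof.
intros Hz. apply Cmod_gt_0. assert (Q := circ_dist z0 z r th Hz). pose proof (Cmod_ge_0 (z - z0)). lra.
Qed.

(** The density h already contains the factor dw / dth. Leaving the exponent n free makes the family
    closed under differentiation in z. *)
Definition cauchy_int (z0 : C) (r : R) (h : R -> C) (n : nat) (z : C) : C :=
  CI (fun th => h th * (/ (circ z0 r th - z)) ^ n)%C 0 (2 * PI).

Lemma PI2_pos : 0 <= 2 * PI.
Proof. pose proof PI_RGT_0; lra. Qed.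

Lemma rdiff_cauchy_integrand (z0 z : C) (r th : R) (h : R -> C) (n : nat) :
  (forall th, rdiff h th) -> Cmod (z - z0) < r / 2 ->
  rdiff (fun th => h th * (/ (circ z0 r th - z)) ^ n)%C th.
Proof.
intros Hh Hz. apply rdiff_mult; auto. apply rdiff_pow, rdiff_inv; [now apply circ_neq|].
apply rdiff_minus; [apply rdiff_circ|apply rdiff_const].
Qed.

Lemma ex_cauchy_int (z0 z : C) (r : R) (h : R -> C) (n : nat) :
  (forall th, rdiff h th) -> Cmod (z - z0) < r / 2 ->
  ex_CI (fun th => h th * (/ (circ z0 r th - z)) ^ n)%C 0 (2 * PI).
Proof.
intros Hh Hz. apply ex_CI_rdiff; [apply PI2_pos|]. intros th _.
now apply rdiff_cauchy_integrand.
Qed.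

(** A Riemann integrable function is bounded, so no separate compactness argument is made. *)
Lemma rdiff_bounded (h : R -> C) (a b : R) :
  a <= b -> (forall t, a <= t <= b -> rdiff h t) ->
  exists B, 0 <= B /\ forall t, a <= t <= b -> Cmod (h t) <= B.
Proof.
intros Hab Hh. destruct (ex_CI_rdiff h a b Hab Hh) as [E1 E2].
apply ex_RInt_ub in E1. apply ex_RInt_ub in E2. destruct E1 as [B1 E1], E2 as [B2 E2].
rewrite Rmin_left, Rmax_right in E1, E2 by auto.
exists (Rabs B1 + Rabs B2). split; [pose proof (Rabs_pos B1); pose proof (Rabs_pos B2); lra|].
intros t Ht. eapply Rle_trans; [apply Cmod_le_Rabs|].
specialize (E1 t Ht). specialize (E2 t Ht).
apply Rplus_le_compat; (eapply Rle_trans; [eassumption|apply Rle_abs]).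
Qed.

(** Integrating [pow_inv_quadratic] against the bounded density h gives a quadratic remainder, with
    h bounded by B and an interval of length 2 pi. *)
Lemma cder_cauchy_int (z0 z : C) (r : R) (h : R -> C) (n : nat) :
  (forall th, rdiff h th) -> Cmod (z - z0) < r / 2 ->
  cder (cauchy_int z0 r h n) z (RtoC (INR n) * cauchy_int z0 r h (S n) z)%C.
Proof.
intros Hh Hz.
assert (Hr : 0 < r) by (pose proof (Cmod_ge_0 (z - z0)); lra).
destruct (rdiff_bounded h 0 (2 * PI) PI2_pos (fun t _ => Hh t)) as [B [B0 HB]].
destruct (pow_inv_quadratic (r / 2) n) as [K HK]; [lra|].
apply cder_of_quadratic with (d := r / 2 - Cmod (z - z0)) (K := 2 * (B * K) * (2 * PI)); [lra|].
intros k Hk.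
assert (Hzk : Cmod (z + k - z0) < r / 2).
{ replace (z + k - z0)%C with ((z - z0) + k)%C by ring.
  eapply Rle_lt_trans; [apply Cmod_triangle|]. lra. }
assert (X0 := ex_cauchy_int z0 z r h n Hh Hz).
assert (X1 := ex_cauchy_int z0 z r h (S n) Hh Hz).
assert (X2 := ex_cauchy_int z0 (z + k) r h n Hh Hzk).
unfold cauchy_int.
replace (CI (fun th => h th * (/ (circ z0 r th - (z + k))) ^ n) 0 (2 * PI)
  - CI (fun th => h th * (/ (circ z0 r th - z)) ^ n) 0 (2 * PI)
  - k * (RtoC (INR n) * CI (fun th => h th * (/ (circ z0 r th - z)) ^ S n) 0 (2 * PI)))%C with
  (CI (fun th => h th * (/ (circ z0 r th - (z + k))) ^ n - h th * (/ (circ z0 r th - z)) ^ n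
    - k * RtoC (INR n) * (h th * (/ (circ z0 r th - z)) ^ S n)) 0 (2 * PI))%C.
2:{ rewrite CI_minus, CI_minus, CI_scal; auto; try ring.
    - apply ex_CI_rdiff; [apply PI2_pos|]. intros th _.
      apply rdiff_minus; now apply rdiff_cauchy_integrand.
    - apply ex_CI_rdiff; [apply PI2_pos|]. intros th _.
      apply rdiff_mult; [apply rdiff_const|now apply rdiff_cauchy_integrand]. }
eapply Rle_trans; [apply Cmod_CI_le with (M := B * (K * (Cmod k * Cmod k)))|].
- apply PI2_pos.
- apply ex_CI_rdiff; [apply PI2_pos|]. intros th _.
  apply rdiff_minus; [apply rdiff_minus; now apply rdiff_cauchy_integrand|].
  apply rdiff_mult; [apply rdiff_const|now apply rdiff_cauchy_integrand].
- intros th Hth.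
  replace (h th * (/ (circ z0 r th - (z + k))) ^ n - h th * (/ (circ z0 r th - z)) ^ n
    - k * RtoC (INR n) * (h th * (/ (circ z0 r th - z)) ^ S n))%C with
   (h th * ((/ (circ z0 r th - z - k)) ^ n - (/ (circ z0 r th - z)) ^ n
     - k * (RtoC (INR n) * (/ (circ z0 r th - z)) ^ S n)))%C.
  2:{ replace (circ z0 r th - z - k)%C with (circ z0 r th - (z + k))%C by ring. ring. }
  rewrite Cmod_mult. apply Rmult_le_compat; auto using Cmod_ge_0.
  apply HK; [now apply circ_dist|].
  replace (circ z0 r th - z - k)%C with (circ z0 r th - (z + k))%C by ring. now apply circ_dist.
- right; ring.
Qed.

(** E'' = f with a bound M valid on the whole disc; M is what makes the remainder of E uniform. *)
Definition holo_derivs (E F f : C -> C) (z0 : C) (rho M : R) : Prop :=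
  forall z, cball z0 rho z -> cder E z (F z) /\ cder F z (f z) /\ Cmod (f z) <= M.

(** Two mean value estimates: one bounds F(w) - F(z) on the segment by 2 M |y - z|, the other is
    applied to E(w) - w F(z), whose derivative is that difference. Their factors 2 give the 4. *)
Lemma taylor_quadratic (E F f : C -> C) (z0 z y : C) (rho M : R) :
  holo_derivs E F f z0 rho M -> cball z0 rho z -> cball z0 rho y ->
  Cmod (E y - E z - (y - z) * F z)%C <= 4 * M * (Cmod (y - z) * Cmod (y - z)).
Proof.
intros H Hz Hy.
assert (HF : forall t, 0 <= t <= 1 -> Cmod (F (z + RtoC t * (y - z)) - F z)%C <= 2 * M * Cmod (y - z)).
{ intros t Ht.
  assert (Hm : cball z0 rho (z + RtoC t * (y - z))) by now apply cball_segment.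
  assert (M0 : 0 <= M) by (eapply Rle_trans; [apply Cmod_ge_0|apply (H z Hz)]).
  eapply Rle_trans; [apply (cder_increment_le F f z (z + RtoC t * (y - z))%C M)|].
  - intros s Hs. apply H. now apply cball_segment.
  - apply Rmult_le_compat_l; [lra|].
    replace (z + RtoC t * (y - z) - z)%C with (RtoC t * (y - z))%C by ring.
    rewrite Cmod_mult, Cmod_R, Rabs_pos_eq by lra.
    rewrite <- (Rmult_1_l (Cmod (y - z))) at 2. apply Rmult_le_compat_r; [apply Cmod_ge_0|lra]. }
assert (A := rder_increment_le (fun t => E (z + RtoC t * (y - z)) - (z + RtoC t * (y - z)) * F z)%C
   (fun t => F (z + RtoC t * (y - z)) * (y - z) - (y - z) * F z)%C (2 * M * Cmod (y - z) * Cmod (y - z))).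
cbv beta in A.
replace (z + RtoC 1 * (y - z))%C with y in A by ring.
replace (z + RtoC 0 * (y - z))%C with z in A by ring.
replace (E y - E z - (y - z) * F z)%C with (E y - y * F z - (E z - z * F z))%C by ring.
eapply Rle_trans; [apply A|right; ring].
intros t Ht. split.
- apply rder_minus.
  + apply (rder_cder_comp E (fun t => z + RtoC t * (y - z))%C); [|apply rder_segment].
    apply H. now apply cball_segment.
  + eapply rder_ext; [reflexivity| |apply rder_mult; [apply rder_segment|apply rder_const]].
    cbv beta; ring.
- replace (F (z + RtoC t * (y - z)) * (y - z) - (y - z) * F z)%C
    with ((F (z + RtoC t * (y - z)) - F z) * (y - z))%C by ring.
  rewrite Cmod_mult. apply Rmult_le_compat_r; [apply Cmod_ge_0|auto].
Qed.

Lemma cball_center (z0 : C) (r : R) : 0 <= r -> cball z0 r z0.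
Proof. intros Hr. unfold cball. replace (z0 - z0)%C with (RtoC 0) by ring. rewrite Cmod_0; lra. Qed.

Lemma cball_circ (z0 : C) (r th : R) : 0 <= r -> cball z0 r (circ z0 r th).
Proof. intros Hr. unfold cball. rewrite Cmod_circ; lra. Qed.

(** For t <> 0 the integrand is the derivative of E along the contracted circle, divided by t; for t
    = 0 it is F(z) times the derivative of the circle. Both primitives take equal values at 0 and 2
    pi. *)
Lemma rder_closed_curve_int (F : C -> C) (E : C -> C) (z0 z : C) (r t : R) :
  (forall y, cball z0 r y -> cder E y (F y)) -> (forall y, cball z0 r y -> exists l, cder F y l) ->
  0 <= r -> cball z0 r z -> 0 <= t <= 1 ->
  CI (fun th => F (z + RtoC t * (circ z0 r th - z)) * circ' r th)%C 0 (2 * PI) = 0.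
Proof.
intros HE HF Hr Hz Ht.
set (c := fun th => (z + RtoC t * (circ z0 r th - z))%C).
assert (Hc : forall th, cball z0 r (c th)).
{ intros th. apply cball_segment; auto. now apply cball_circ. }
assert (Dc : forall th, rder c th (RtoC t * circ' r th)%C).
{ intros th. eapply rder_ext; [reflexivity| |apply rder_plus; [apply rder_const|apply rder_mult;
    [apply rder_const|apply rder_minus; [apply rder_circ|apply rder_const]]]].
  cbv beta; ring. }
assert (DF : forall th, rdiff (fun th => F (c th) * circ' r th)%C th).
{ intros th. apply rdiff_mult; [|apply rdiff_circ'].
  destruct (HF _ (Hc th)) as [l Hl]. eapply rdiff_cder_comp; eauto. eexists; apply Dc. }
destruct (Req_dec t 0) as [->|Nt].
- rewrite (CI_rder (fun th => F z * circ z0 r th)%C).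
  + rewrite circ_2PI. ring.
  + apply PI2_pos.
  + intros th _. eapply rder_ext; [reflexivity| |apply rder_mult; [apply rder_const|apply rder_circ]].
    cbv beta. replace (z + RtoC 0 * (circ z0 r th - z))%C with z by ring. ring.
  + intros th _. apply DF.
- rewrite (CI_rder (fun th => / RtoC t * E (c th))%C).
  + unfold c. rewrite circ_2PI. ring.
  + apply PI2_pos.
  + intros th _. eapply rder_ext; [reflexivity| |apply rder_mult; [apply rder_const|
      apply rder_cder_comp; [apply HE, Hc|apply Dc]]].
    cbv beta. unfold c. field. intros Q. apply Nt. exact (f_equal fst Q).
  + intros th _. apply DF.
Qed.

(* Deform the integrand along the segments from [z] to the circle: the derivative in the
   deformation parameter [t] of the integral of [E (z + t (w - z)) dw / (w - z)] is an integral
   of an exact form over a closed curve, hence zero. *)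
Lemma cauchy_formula (E F f : C -> C) (z0 z : C) (r M : R) :
  holo_derivs E F f z0 r M -> Cmod (z - z0) < r / 2 ->
  cauchy_int z0 r (fun th => E (circ z0 r th) * circ' r th)%C 1 z =
  (E z * cauchy_int z0 r (circ' r) 1 z)%C.
Proof.
intros H Hz.
assert (Hr : 0 < r) by (pose proof (Cmod_ge_0 (z - z0)); lra).
assert (Hzr : cball z0 r z) by (unfold cball; lra).
assert (Hm : forall t th, 0 <= t <= 1 -> cball z0 r (z + RtoC t * (circ z0 r th - z))%C).
{ intros t th Ht. apply cball_segment; auto. apply cball_circ; lra. }
set (k := fun th => (circ' r th * (/ (circ z0 r th - z)) ^ 1)%C).
assert (Dk : forall th, rdiff k th).
{ intros th. apply rdiff_cauchy_integrand; auto. apply rdiff_circ'. }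
set (phi := fun t => CI (fun th => E (z + RtoC t * (circ z0 r th - z)) * k th)%C 0 (2 * PI)).
assert (Dm : forall t th, rdiff (fun th => z + RtoC t * (circ z0 r th - z))%C th).
{ intros t th. apply rdiff_plus; [apply rdiff_const|]. apply rdiff_mult; [apply rdiff_const|].
  apply rdiff_minus; [apply rdiff_circ|apply rdiff_const]. }
assert (DE : forall t th, 0 <= t <= 1 -> rdiff (fun th => E (z + RtoC t * (circ z0 r th - z)) * k th)%C th).
{ intros t th Ht. apply rdiff_mult; auto.
  apply (rdiff_cder_comp E (fun th => z + RtoC t * (circ z0 r th - z))%C th (F (z + RtoC t * (circ z0 r th - z)))%C);
    auto. apply H; auto. }
assert (DF : forall t th, 0 <= t <= 1 -> rdiff (fun th => F (z + RtoC t * (circ z0 r th - z)) * circ' r th)%C th).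
{ intros t th Ht. apply rdiff_mult; [|apply rdiff_circ'].
  apply (rdiff_cder_comp F (fun th => z + RtoC t * (circ z0 r th - z))%C th (f (z + RtoC t * (circ z0 r th - z)))%C);
    auto. apply H; auto. }
assert (C1 : phi 1 = phi 0).
{ apply (constant_of_quadratic phi (2 * (4 * M * (2 * r * r)) * (2 * PI - 0))).
  intros t s Ht Hs.
  assert (Z := rder_closed_curve_int F E z0 z r t (fun y Hy => proj1 (H y Hy))
    (fun y Hy => ex_intro _ _ (proj1 (proj2 (H y Hy)))) (Rlt_le _ _ Hr) Hzr Ht).
  (* Subtracting s - t times a vanishing integral turns the integrand into a Taylor remainder of E
     times the kernel. That remainder carries |w - z|^2, one factor of which cancels the kernel's
     denominator; the other is at most 2 r. *)
  replace (phi s - phi t)%C with (phi s - phi t - RtoC (s - t) *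
    CI (fun th => F (z + RtoC t * (circ z0 r th - z)) * circ' r th) 0 (2 * PI))%C by (rewrite Z; ring).
  unfold phi.
  assert (X1 : ex_CI (fun th => E (z + RtoC s * (circ z0 r th - z)) * k th)%C 0 (2 * PI))
    by (apply ex_CI_rdiff; auto using PI2_pos).
  assert (X2 : ex_CI (fun th => E (z + RtoC t * (circ z0 r th - z)) * k th)%C 0 (2 * PI))
    by (apply ex_CI_rdiff; auto using PI2_pos).
  assert (X3 : ex_CI (fun th => F (z + RtoC t * (circ z0 r th - z)) * circ' r th)%C 0 (2 * PI))
    by (apply ex_CI_rdiff; auto using PI2_pos).
  rewrite <- CI_scal by auto.
  rewrite <- (CI_minus _ _ 0 (2 * PI) X1 X2).
  rewrite <- CI_minus.
  2:{ apply ex_CI_rdiff; [apply PI2_pos|]. intros; apply rdiff_minus; auto. }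
  2:{ apply ex_CI_rdiff; [apply PI2_pos|]. intros; apply rdiff_mult; [apply rdiff_const|auto]. }
  eapply Rle_trans; [apply Cmod_CI_le with (M := 4 * M * (2 * r * r) * (s - t) ^ 2)|right; ring].
  - apply PI2_pos.
  - apply ex_CI_rdiff; [apply PI2_pos|]. intros. apply rdiff_minus; [apply rdiff_minus; auto|].
    apply rdiff_mult; [apply rdiff_const|auto].
  - intros th _. specialize (Hm t th Ht) as Hmt. specialize (Hm s th Hs) as Hms.
    assert (Q := taylor_quadratic E F f z0 _ _ r M H Hmt Hms).
    assert (N := circ_neq z0 z r th Hz).
    set (w := circ z0 r th) in *.
    replace (z + RtoC s * (w - z) - (z + RtoC t * (w - z)))%C with (RtoC (s - t) * (w - z))%C in Q
      by (rewrite RtoC_minus; ring).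
    replace (E (z + RtoC s * (w - z)) * k th - E (z + RtoC t * (w - z)) * k th
      - RtoC (s - t) * (F (z + RtoC t * (w - z)) * circ' r th))%C with
     ((E (z + RtoC s * (w - z)) - E (z + RtoC t * (w - z)) - RtoC (s - t) * (w - z) * F (z + RtoC t * (w - z)))
       * k th)%C.
    2:{ unfold k. fold w. cbn [Cpow]. field. auto. }
    rewrite Cmod_mult.
    assert (Ek : Cmod (k th) = r / Cmod (w - z)).
    { unfold k. fold w. cbn [Cpow]. rewrite Cmult_1_r, Cmod_mult, Cmod_inv, Cmod_circ' by (auto; lra). reflexivity. }
    assert (Wp : 0 < Cmod (w - z)) by now apply Cmod_gt_0.
    assert (W2 : Cmod (w - z) <= 2 * r).
    { assert (Q' := Cmod_sub_tri w z0 z). unfold w in Q' at 2. rewrite Cmod_circ in Q' by lra.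
      rewrite (Cmod_sub_sym z0 z) in Q'. lra. }
    apply Rle_trans with (4 * M * (Cmod (RtoC (s - t) * (w - z)) * Cmod (RtoC (s - t) * (w - z))) * Cmod (k th)).
    { apply Rmult_le_compat_r; auto. apply Cmod_ge_0. }
    rewrite Ek, !Cmod_mult, Cmod_R.
    replace (4 * M * (Rabs (s - t) * Cmod (w - z) * (Rabs (s - t) * Cmod (w - z))) * (r / Cmod (w - z)))
      with (4 * M * (Cmod (w - z) * r) * (Rabs (s - t) * Rabs (s - t))) by (field; lra).
    rewrite <- Rabs_mult, Rabs_pos_eq by apply Rle_0_sqr.
    replace ((s - t) * (s - t)) with ((s - t) ^ 2) by ring.
    apply Rmult_le_compat_r; [apply pow2_ge_0|].
    assert (M0 : 0 <= M) by (eapply Rle_trans; [apply Cmod_ge_0|apply (H z Hzr)]).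
    apply Rmult_le_compat_l; [lra|]. apply Rmult_le_compat_r; lra. }
unfold cauchy_int.
transitivity (phi 1).
- unfold phi. apply CI_ext; [apply PI2_pos|]. intros th _. unfold k.
  replace (z + RtoC 1 * (circ z0 r th - z))%C with (circ z0 r th) by ring. ring.
- rewrite C1, <- CI_scal.
  + apply CI_ext; [apply PI2_pos|]. intros th _. unfold k.
    replace (z + RtoC 0 * (circ z0 r th - z))%C with z by ring. ring.
  + apply ex_cauchy_int; auto. intros; apply rdiff_circ'.
Qed.

(** The derivative in z is the integral of order 2, which vanishes because - 1 / (w - z) is a
    primitive on the closed circle. Hence the value is that at the centre, where the integrand is
    the constant i. *)
Lemma cauchy_kernel_int (z0 z : C) (r : R) : Cmod (z - z0) < r / 2 ->
  cauchy_int z0 r (circ' r) 1 z = (RtoC (2 * PI) * Ci)%C.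
Proof.
intros Hz.
assert (Hr : 0 < r) by (pose proof (Cmod_ge_0 (z - z0)); lra).
assert (D0 : forall y, Cmod (y - z0) < r / 2 -> cauchy_int z0 r (circ' r) 2 y = 0).
{ intros y Hy. unfold cauchy_int. rewrite (CI_rder (fun th => - (1) * / (circ z0 r th - y))%C).
  - rewrite circ_2PI. ring.
  - apply PI2_pos.
  - intros th _. eapply rder_ext; [reflexivity| |apply rder_mult; [apply rder_const|
      apply rder_inv; [|apply rder_minus; [apply rder_circ|apply rder_const]]]].
    + cbv beta. cbn [Cpow]. ring.
    + now apply circ_neq.
  - intros th _. apply rdiff_cauchy_integrand; auto. intros; apply rdiff_circ'. }
transitivity (cauchy_int z0 r (circ' r) 1 z0).
(* The increment bound with M = 0 gives constancy along the segment from the centre. *)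
- assert (A := cder_increment_le (cauchy_int z0 r (circ' r) 1)
    (fun y => RtoC (INR 1) * cauchy_int z0 r (circ' r) 2 y)%C z0 z 0).
  rewrite Rmult_0_r, Rmult_0_l in A.
  apply Rle_antisym in A; [|apply Cmod_ge_0|].
  + symmetry in A. apply Cmod_eq_0 in A. rewrite <- (Cplus_0_l (cauchy_int z0 r (circ' r) 1 z0)), <- A. ring.
  + intros t Ht.
    assert (B : Cmod (z0 + RtoC t * (z - z0) - z0) < r / 2).
    { eapply Rle_lt_trans; [|exact Hz]. apply (cball_segment z0 z0 z (Cmod (z - z0)) t); auto.
      - apply cball_center, Cmod_ge_0.
      - apply Rle_refl. }
    split.
    * apply cder_cauchy_int; auto. intros; apply rdiff_circ'.
    * rewrite D0 by auto. rewrite Cmult_0_r, Cmod_0; lra.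
- unfold cauchy_int. rewrite (CI_rder (fun th => Ci * RtoC th)%C).
  + rewrite Cmult_0_r. ring.
  + apply PI2_pos.
  + intros th _. eapply rder_ext; [reflexivity| |apply rder_mult; [apply rder_const|apply rder_id]].
    cbv beta. rewrite (circ'_eq z0). cbn [Cpow]. field. apply circ_neq.
    replace (z0 - z0)%C with (RtoC 0) by ring. rewrite Cmod_0. lra.
  + intros th _. apply rdiff_cauchy_integrand; [intros; apply rdiff_circ'|].
    replace (z0 - z0)%C with (RtoC 0) by ring. rewrite Cmod_0. lra.
Qed.

Lemma two_pi_i_neq : (RtoC (2 * PI) * Ci)%C <> 0.
Proof. intros Q. apply (f_equal snd) in Q. cbn in Q. pose proof PI_RGT_0. lra. Qed.

(** The one regularity statement needed later: near z0 the derivative g of f is again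
    differentiable. Naming g allows it to be identified with [C_derive f] afterwards. *)
Lemma cder_cder_of_cball (f : C -> C) (z0 : C) (rho : R) :
  0 < rho -> holo_cball f z0 rho ->
  exists r g, 0 < r /\ forall z, Cmod (z - z0) < r -> cder f z (g z) /\ exists l, cder g z l.
Proof.
intros Hrho Hf.
(* Each primitive needs a strictly larger disc for its integrand, hence the radii rho / 2, rho / 3,
   rho / 4 and finally rho / 5. The radius d below keeps f within 1 of f z0, so M = 1 + |f z0|. *)
destruct (exists_primitive f z0 (rho / 2) rho) as [F HF]; [lra|auto|].
destruct (exists_primitive F z0 (rho / 4) (rho / 3)) as [E HE]; [lra| |].
{ intros z Hz. exists (f z). apply HF. unfold cball in Hz; lra. }
destruct (Hf z0) as [l0 Hl0]; [apply cball_center; lra|].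
destruct (cder_continuous f z0 l0 1 Hl0) as [d [Pd Hd]]; [lra|].
set (r := Rmin (d / 2) (rho / 5)).
assert (Hr : 0 < r) by (apply Rmin_pos; lra).
assert (Hrd : r < d) by (pose proof (Rmin_l (d / 2) (rho / 5)); unfold r; lra).
assert (Hr5 : r <= rho / 5) by apply Rmin_r.
set (M := 1 + Cmod (f z0)).
assert (HD : holo_derivs E F f z0 r M).
{ intros z Hz. unfold cball in Hz. split; [apply HE; lra|]. split; [apply HF; lra|].
  specialize (Hd (z - z0)%C). replace (z0 + (z - z0))%C with z in Hd by ring.
  replace (f z) with ((f z - f z0) + f z0)%C by ring.
  eapply Rle_trans; [apply Cmod_triangle|]. unfold M. apply Rplus_le_compat_r, Hd. lra. }
set (h := fun th => (E (circ z0 r th) * circ' r th)%C).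
assert (Dh : forall th, rdiff h th).
{ intros th. apply rdiff_mult; [|apply rdiff_circ'].
  apply (rdiff_cder_comp E (circ z0 r) th (F (circ z0 r th))); [|apply rdiff_circ].
  apply HD, cball_circ; lra. }
set (kap := (/ (RtoC (2 * PI) * Ci))%C).
set (G := fun n z => (kap * cauchy_int z0 r h n z)%C).
assert (DG : forall n z, Cmod (z - z0) < r / 2 -> cder (G n) z (RtoC (INR n) * G (S n) z)%C).
{ intros n z Hz. unfold G.
  replace (RtoC (INR n) * (kap * cauchy_int z0 r h (S n) z))%C with
    (kap * (RtoC (INR n) * cauchy_int z0 r h (S n) z))%C by ring.
  apply cder_scal. now apply cder_cauchy_int. }
assert (EE : forall z, Cmod (z - z0) < r / 2 -> E z = G 1%nat z).
{ intros z Hz. unfold G, h. rewrite (cauchy_formula E F f z0 z r M HD Hz), cauchy_kernel_int by auto.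
  unfold kap. rewrite (Cmult_comm (E z)), Cmult_assoc, Cinv_l by apply two_pi_i_neq. ring. }
assert (EF : forall z, Cmod (z - z0) < r / 2 -> F z = G 2%nat z).
{ intros z Hz. apply (cder_unique E z).
  - apply HD. unfold cball; lra.
  - apply (cder_ext_ball (G 1%nat) E z0 z (RtoC (INR 1) * G 2%nat z)%C _ (r / 2)); auto.
    + intros y Hy. symmetry; auto.
    + simpl INR; ring. }
assert (Ef : forall z, Cmod (z - z0) < r / 2 -> f z = (RtoC (INR 2) * G 3%nat z)%C).
{ intros z Hz. apply (cder_unique F z).
  - apply HD. unfold cball; lra.
  - apply (cder_ext_ball (G 2%nat) F z0 z (RtoC (INR 2) * G 3%nat z)%C _ (r / 2)); auto.
    intros y Hy. symmetry; auto. }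
(* [G n] has derivative n [G (n + 1)], and E is [G 1]; so F is [G 2], f is 2 [G 3], and f' is 2 * 3
   [G 4]. *)
exists (r / 2), (fun z => RtoC (INR 2) * (RtoC (INR 3) * G 4%nat z))%C. split; [lra|].
intros z Hz. split.
- apply (cder_ext_ball (fun z => RtoC (INR 2) * G 3%nat z)%C f z0 z _ _ (r / 2)
    Hz (fun y Hy => eq_sym (Ef y Hy)) eq_refl). apply cder_scal. now apply DG.
- eexists. apply cder_scal, cder_scal. now apply DG.
Qed.

(** The [ball] of [C] is a square, from the product structure; it contains the disc of the same
    radius. *)
Lemma ball_C_of_Cmod (z w : C) (r : R) : Cmod (w - z) < r -> ball z r w.
Proof. exact (C_NormedModule_mixin_compat1 z w r). Qed.

Lemma holomorphic_C_derive (D : C -> Prop) (f : C -> C) :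
  open D -> holomorphic_on D f -> holomorphic_on D (C_derive f).
Proof.
intros HD Hf z0 Hz0.
destruct (HD z0 Hz0) as [e He].
assert (Hf' : holo_cball f z0 (e / 2)).
{ intros z Hz. apply Hf, He, ball_C_of_Cmod. pose proof (cond_pos e). unfold cball in Hz; lra. }
destruct (cder_cder_of_cball f z0 (e / 2)) as [r [g [Hr H]]]; auto.
{ pose proof (cond_pos e); lra. }
assert (Hz : Cmod (z0 - z0) < r).
{ replace (z0 - z0)%C with (RtoC 0) by ring. now rewrite Cmod_0. }
destruct (H z0 Hz) as [_ [l Hl]]. exists l.
apply (cder_ext_ball g (C_derive f) z0 z0 l l r Hz); auto.
intros y Hy. symmetry. apply is_C_derive_unique, H, Hy.
Qed.

Lemma holomorphic_C_derive_n (D : C -> Prop) (f : C -> C) (n : nat) :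
  open D -> holomorphic_on D f -> holomorphic_on D (C_derive_n f n).
Proof.
intros HD Hf. induction n; simpl; auto. now apply holomorphic_C_derive.
Qed.

(** * Bounded derivatives on convex domains *)

Lemma bounded_of_C_derive_bounded (D : C -> Prop) (f : C -> C) :
  C_bounded D -> C_convex D -> holomorphic_on D f ->
  (exists M, forall z, D z -> Cmod (C_derive f z) <= M) ->
  exists M, forall z, D z -> Cmod (f z) <= M.
Proof.
intros [B HB] Hconv Hf [M HM].
destruct (classic (exists a, D a)) as [[a Ha]|N].
2:{ exists 0. intros z Hz. exfalso; eauto. }
(* Here 2 M is the Lipschitz constant from the increment bound and 2 B bounds the distance from z to
   the base point a. *)
exists (2 * M * (2 * B) + Cmod (f a)). intros z Hz.
assert (M0 : 0 <= M) by (eapply Rle_trans; [apply Cmod_ge_0|apply (HM a Ha)]).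
replace (f z) with ((f z - f a) + f a)%C by ring.
eapply Rle_trans; [apply Cmod_triangle|]. apply Rplus_le_compat_r.
eapply Rle_trans; [apply (cder_increment_le f (C_derive f) a z M)|].
- intros t Ht.
  assert (Dt : D (a + RtoC t * (z - a))%C).
  { replace (a + RtoC t * (z - a))%C with (RtoC (1 - t) * a + RtoC t * z)%C; [now apply Hconv|].
    rewrite RtoC_minus; ring. }
  split; auto. apply C_derive_correct; auto.
- apply Rmult_le_compat_l; [lra|]. eapply Rle_trans; [apply Cmod_sub_le|].
  specialize (HB z Hz) as H1. specialize (HB a Ha) as H2. lra.
Qed.

Lemma C_derive_n_bounded_of_higher (D : C -> Prop) (f : C -> C) (k n : nat) :
  open D -> C_bounded D -> C_convex D -> holomorphic_on D f ->
  (exists M, forall z, D z -> Cmod (C_derive_n f (k + n) z) <= M) ->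
  exists M, forall z, D z -> Cmod (C_derive_n f n z) <= M.
Proof.
intros HD HB Hc Hf. induction k; simpl; auto.
intros H. apply IHk. apply bounded_of_C_derive_bounded; auto.
now apply holomorphic_C_derive_n.
Qed.

(** * Orders of derivatives up to the supremum *)

Lemma Ftilde0_of_mem (F : nat -> Prop) (l : nat) : F l -> Ftilde0 F l.
Proof.
intros Hl. unfold Ftilde0, sup_nat.
apply (Lub_Rbar_correct (fun x => exists n, F n /\ x = INR n)). exists l; auto.
Qed.

(** If every member of F were below l, then l - 1 would be an upper bound, contradicting l <= sup F.
    This treats finite and infinite suprema alike. *)
Lemma Ftilde0_le_mem (F : nat -> Prop) (l : nat) :
  (exists m, F m) -> Ftilde0 F l -> exists m, F m /\ (l <= m)%nat.
Proof.
intros [m0 Hm0] Hl. apply NNPP; intros N.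
assert (U : forall m, F m -> (m < l)%nat).
{ intros m Hm. destruct (Nat.lt_ge_cases m l); auto. exfalso; eauto. }
unfold Ftilde0, sup_nat in Hl.
assert (V : Rbar_le (Lub_Rbar (fun x => exists n, F n /\ x = INR n)) (INR (l - 1))).
{ apply (Lub_Rbar_correct (fun x => exists n, F n /\ x = INR n)).
  intros x [n [Hn ->]]. simpl. apply le_INR. specialize (U n Hn). lia. }
assert (W := Rbar_le_trans _ _ _ Hl V). simpl in W. apply INR_le in W.
(* A member below l forces l > 0, so the truncated l - 1 is a true predecessor and l <= l - 1 is
   absurd. *)
specialize (U m0 Hm0). lia.
Qed.

Theorem theorem4p7 :
  forall (Omega : C -> Prop) (F : nat -> Prop),
    C_domain Omega -> C_bounded Omega -> C_convex Omega ->
    (exists l, F l) ->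
    forall f : C -> C, Hinf F Omega f <-> Hinf (Ftilde0 F) Omega f.
Proof.
intros Omega F [Hopen _] Hb Hc HF f. split; intros [Hf H]; split; auto.
- intros l Hl. destruct (Ftilde0_le_mem F l HF Hl) as [m [Hm Hlm]].
  apply (C_derive_n_bounded_of_higher Omega f (m - l) l); auto.
  rewrite Nat.sub_add by auto. auto.
- intros l Hl. apply H. now apply Ftilde0_of_mem.
Qed.
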